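(* For any $n\ge1$, writing $\epsilon_{\mathrm{odd}}(F)$ for the expression equal to $0$ if $n$ is even and $F$ if $n$ is odd, and $\epsilon_{\mathrm{even}}(F)$ for $F$ if $n$ is even and $0$ if $n$ is odd: (i) $\sum_{\pi\in\mathfrak{S}_n(132)}(-1)^{\mathsf{des}\,\pi}q^{(2\text{-}31)\pi}=\sum_{\pi\in\mathfrak{S}_n(132)}(-1)^{\mathsf{des}\,\pi}q^{(2\text{-}13)\pi}=\epsilon_{\mathrm{odd}}\big((-q)^{(n-1)/2}C_{(n-1)/2}(q^2)\big)$; (ii) $\sum_{\pi\in\mathfrak{S}_n(213)}(-1)^{\mathsf{des}\,\pi}q^{(31\text{-}2)\pi}=\sum_{\pi\in\mathfrak{S}_n(213)}(-1)^{\mathsf{des}\,\pi}q^{(13\text{-}2)\pi}=\epsilon_{\mathrm{odd}}\big((-q)^{(n-1)/2}C_{(n-1)/2}(q^2)\big)$; (iii) $\sum_{\pi\in\mathfrak{S}_n(312)}(-1)^{\mathsf{des}\,\pi}q^{(2\text{-}31)\pi}=\sum_{\pi\in\mathfrak{S}_n(312)}(-1)^{\mathsf{des}\,\pi}q^{(2\text{-}13)\pi}=\epsilon_{\mathrm{odd}}\big((-q)^{(n-1)/2}C_{(n-1)/2}(q^2)\big)$; (iv) $\sum_{\pi\in\mathfrak{D}^*_n(132)}(-1)^{\mathsf{des}\,\pi}q^{(2\text{-}31)\pi}=\epsilon_{\mathrm{even}}\big((-1)^{n/2}\widehat{C}_{n/2}(q)\big)$; (v) $\sum_{\pi\in\mathfrak{D}^*_n(132)}(-q)^{\mathsf{des}\,\pi}q^{(31\text{-}2)\pi}=\epsilon_{\mathrm{even}}\big((-q)^{n/2}\overline{C}_{n/2}(q)\big)$;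 (vi) $\sum_{\pi\in\mathfrak{D}^*_n(213)}(-1)^{\mathsf{des}\,\pi}q^{(13\text{-}2)\pi}=\epsilon_{\mathrm{even}}\big((-1)^{n/2}q^{(n-2)/2}C_{(n-2)/2}(q^2)\big)$; (vii) $\sum_{\pi\in\mathfrak{D}^*_n(213)}(-q)^{\mathsf{des}\,\pi}q^{(31\text{-}2)\pi}=\epsilon_{\mathrm{even}}\big((-1)^{n/2}q^{(3n-4)/2}C_{(n-2)/2}(q^2)\big)$; where $\widehat{C}_m(q):=\sum_{\pi\in\mathfrak{A}_{2m}(231)}q^{(13\text{-}2)\pi}$ and $\overline{C}_m(q):=\sum_{\pi\in\mathfrak{A}_{2m}(231)}q^{(2\text{-}13)\pi}$.
   Context: $C_n(q):=C_n(q,q^2)$, where $C_n(t,q)$ is defined by $\sum_{n\ge0}C_n(t,q)z^n=1/(1-c_1z/(1-c_2z/(1-c_3z/\cdots)))$ with $c_{2k-1}=q^{k-1}$, $c_{2k}=tq^{k-1}$. $\mathfrak{S}_n(\tau)$: permutations of $[n]$ avoiding classical pattern $\tau$. For $\pi\in\mathfrak{S}_n$ set $\pi(n+1)=n+1$; $\pi(i)$ is a foremaximum if $\pi(i)<\pi(i+1)$ and $\pi(i)=\max\{\pi(1),\dots,\pi(i)\}$; a coderangement has no foremaximum; $\mathfrak{D}^*_n(\tau)$ is the set of coderangements in $\mathfrak{S}_n(\tau)$. $\mathfrak{A}_n(\tau)$ is the set of alternating (up-down) permutations $\pi(1)<\pi(2)>\pi(3)<\cdots$ in $\mathfrak{S}_n(\tau)$.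 $\mathsf{des}\,\pi=\#\{i\in[n-1]:\pi(i)>\pi(i+1)\}$; $(31\text{-}2)\pi=\#\{(i,j):i+1<j\le n,\pi(i+1)<\pi(j)<\pi(i)\}$, $(2\text{-}31)\pi=\#\{(i,j):j<i<n,\pi(i+1)<\pi(j)<\pi(i)\}$, $(2\text{-}13)\pi=\#\{(i,j):j<i<n,\pi(i)<\pi(j)<\pi(i+1)\}$, $(13\text{-}2)\pi=\#\{(i,j):i+1<j\le n,\pi(i)<\pi(j)<\pi(i+1)\}$. *)

(* Defs.v *)
From HB Require Import structures.
From mathcomp Require Import all_boot all_order all_algebra all_fingroup.
Set Implicit Arguments. Unset Strict Implicit. Unset Printing Implicit Defensive.
Import GRing.Theory.

Definition cf_coef (R : comRingType) (t q : R) (j : nat) : R :=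
  ((if odd j then 1 else t) * q ^+ (j.-1)./2)%R.

(* cfrac t q m j d = 1/(1 - c_j z/(1 - c_{j+1} z/( ... /(1 - c_{j+d-1} z)))),
   as a polynomial in z = 'X, correct modulo z^m (the geometric series
   1/(1-u) is truncated to \sum_{i<m} u^i, exact mod z^m since u = z*G). *)
Fixpoint cfrac (R : comRingType) (t q : R) (m j d : nat) : {poly R} :=
  match d with
  | 0 => 1%R
  | d'.+1 => (\sum_(i < m) ('X * (cf_coef t q j *: cfrac t q m j.+1 d')) ^+ i)%R
  end.

(* C_n(t,q) = [z^n] 1/(1 - c_1 z/(1 - c_2 z/ ...)); the coefficient of z^n only
   depends on the first n+1 levels and on the series mod z^(n+1). *)
Definition Ctq (R : comRingType) (n : nat) (t q : R) : R :=
  (cfrac t q n.+1 1 n.+1)`_n.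

Definition Cq (R : comRingType) (n : nat) (q : R) : R := Ctq n q (q ^+ 2)%R.

(* value of pi at 0-based position k, with the convention pi(n+1) = n+1,
   i.e. value n (0-based) at positions >= n *)
Definition pv (n : nat) (s : 'S_n) (k : nat) : nat :=
  nth n [seq val (s i) | i <- enum 'I_n] k.

Definition contains (n : nat) (s : 'S_n) (tau : seq nat) : bool :=
  [exists f : {ffun 'I_(size tau) -> 'I_n},
    [forall a : 'I_(size tau), forall b : 'I_(size tau),
      ((a < b) ==> (f a < f b)) &&
      ((s (f a) < s (f b)) == (nth 0 tau a < nth 0 tau b))]].

Definition avoids (n : nat) (s : 'S_n) (tau : seq nat) : bool :=
  ~~ contains s tau.

Definition des (n : nat) (s : 'S_n) : nat :=
  #|[set i : 'I_n | (i.+1 < n) && (pv s i.+1 < pv s i)]|.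

Definition st31_2 (n : nat) (s : 'S_n) : nat :=
  #|[set p : 'I_n * 'I_n | (p.1.+1 < p.2) &&
      (pv s p.1.+1 < pv s p.2 < pv s p.1)]|.

Definition st2_31 (n : nat) (s : 'S_n) : nat :=
  #|[set p : 'I_n * 'I_n | [&& p.2 < p.1, p.1.+1 < n &
      pv s p.1.+1 < pv s p.2 < pv s p.1]]|.

Definition st2_13 (n : nat) (s : 'S_n) : nat :=
  #|[set p : 'I_n * 'I_n | [&& p.2 < p.1, p.1.+1 < n &
      pv s p.1 < pv s p.2 < pv s p.1.+1]]|.

Definition st13_2 (n : nat) (s : 'S_n) : nat :=
  #|[set p : 'I_n * 'I_n | (p.1.+1 < p.2) &&
      (pv s p.1 < pv s p.2 < pv s p.1.+1)]|.

(* foremaximum at position i (with pi(n+1) = n+1) *)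
Definition foremax (n : nat) (s : 'S_n) (i : 'I_n) : bool :=
  (pv s i < pv s i.+1) && [forall j : 'I_n, (j <= i) ==> (s j <= s i)].

Definition coderangement (n : nat) (s : 'S_n) : bool :=
  [forall i : 'I_n, ~~ foremax s i].

Definition alternating (n : nat) (s : 'S_n) : bool :=
  [forall i : 'I_n, (i.+1 < n) ==>
     (if odd i then pv s i.+1 < pv s i else pv s i < pv s i.+1)].

Local Open Scope ring_scope.

Definition Chat (m : nat) : {poly int} :=
  \sum_(s : 'S_(2 * m) | alternating s && avoids s [:: 2; 3; 1]%N)
     'X ^+ (st13_2 s).
Definition Cbar (m : nat) : {poly int} :=
  \sum_(s : 'S_(2 * m) | alternating s && avoids s [:: 2; 3; 1]%N)
     'X ^+ (st2_13 s).

(* Main.v *)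
(* Reversal and complementation reduce all the sums to words avoiding 132 with
   respect to a strict total order r (either < or >).  Splitting such a word at
   its r-maximum m as L m R forces every letter of L to lie above every letter of
   R, and each statistic involved is additive along this splitting up to a term
   read off from |L|, the first letter of R or the last letter of L.  The sums
   hence satisfy convolution recurrences.

   The Cq n x are the Carlitz-Riordan numbers, as c_j = x^(j-1); so the recurrence
   a(n+1) = [n = 0] + y \sum_k x^(n-k) a(n-k) a(k), a(0) = 0, has the solution
   a(2m+1) = (y x)^m Cq m (x^2), a(2m) = 0.  For 2-31 in (i), the generating
   function F(z) satisfies F = 1 + z F - z F(qz) (F - 1), so F - 1 solves this
   recurrence; the other cases need an auxiliary series that also records the
   number of letters above (or below) the first or last one.  For (iv) and (v) the
   coderangement sums and the alternating sums obey the same recurrence up to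
   signs. *)
Require Import Defs.
From HB Require Import structures.
From mathcomp Require Import all_boot all_order all_algebra all_fingroup.
From mathcomp Require Import zify ring.
Set Implicit Arguments. Unset Strict Implicit. Unset Printing Implicit Defensive.
Import GRing.Theory.

(** * Words and the splitting at the maximum *)

Definition strict_total (r : rel nat) :=
  [/\ transitive r, irreflexive r & forall x y, x != y -> r x y || r y x].

(** With [ltn] this is 31-2 and with [flip ltn] it is 13-2; on the reversed word the same two
    relations give 2-13 and 2-31. *)
Fixpoint vinc (r : rel nat) (s : seq nat) : nat :=
  if s is x :: s' then
    count (fun c => r (head x s') c && r c x) s' + vinc r s'
  else 0.

(** At the last letter the default turns the test into [r x x], which is false for an irreflexive
    [r]. *)
Fixpoint desc (r : rel nat) (s : seq nat) : nat :=
  if s is x :: s' then r (head x s') x + desc r s' else 0.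

(** This is what a larger letter placed in front of [s] adds to [vinc r]. On [rev s] it concerns the
    last letter; with [flip r] it counts the letters below. *)
Definition above_head (r : rel nat) (s : seq nat) : nat :=
  count (r (head 0 s)) s.

(** Avoidance of 312, 231 and 213 is obtained by flipping [r], by reversing the word, and by doing
    both. *)
Fixpoint avoid132 (r : rel nat) (s : seq nat) : bool :=
  if s is x :: s' then
    pairwise (fun y z => ~~ (r x z && r z y)) s' && avoid132 r s'
  else true.

(* [p] is the part of the word already read *)
Fixpoint no_foremax (r : rel nat) (p s : seq nat) : bool :=
  if s is x :: s' then
    ~~ (all (r^~ x) p && (if s' is y :: _ then r x y else true))
    && no_foremax r (x :: p) s'
  else true.

Fixpoint zigzag (r : rel nat) (up : bool) (s : seq nat) : bool :=
  if s is x :: s' then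
    (if s' is y :: _ then (if up then r x y else r y x) else true)
    && zigzag r (~~ up) s'
  else true.

(** The third condition reflects that a letter of [L] below a letter of [R] would form 132 with [m]
    between them. *)
Definition max_split (r : rel nat) (L : seq nat) (m : nat) (R : seq nat) :=
  [&& all (r^~ m) L, all (r^~ m) R & allrel r R L].

Lemma in_pairwise (P : rel nat) s :
  {in s &, forall y z, P y z} -> pairwise P s.
Proof.
elim: s => //= x s IHs sP; apply/andP; split.
  by apply/allP => y ys; apply: sP; rewrite inE ?eqxx ?ys ?orbT.
by apply: IHs => y z ys zs; apply: sP; rewrite inE ?ys ?zs orbT.
Qed.

(** * Unique splitting of a 132-avoiding word at its maximum *)

Section MaxDecomposition.

Variable r : rel nat.
Hypothesis r_tot : strict_total r.

Let r_trans : transitive r. Proof. by case: r_tot. Qed.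
Let r_irr : irreflexive r. Proof. by case: r_tot. Qed.
Let r_asym x y : r x y -> r y x = false.
Proof. by move=> xy; apply/negP => /(r_trans xy); rewrite r_irr. Qed.

(** An occurrence straddling [m] must take its 1 in [L] and its 2 in [R], since [m] can only play 3;
    then that 1, [m] and that 2 already form an occurrence. *)
Lemma avoid132_cat L m R : all (r^~ m) L -> all (r^~ m) R ->
  avoid132 r (L ++ m :: R)
  = [&& allrel (fun x y => ~~ r x y) L R, avoid132 r L & avoid132 r R].
Proof.
elim: L => [_|x L IHL /= /andP[xm Lm]] Rm /=.
  rewrite in_pairwise // => y z _ zR.
  by rewrite (r_asym (allP Rm _ zR)).
rewrite IHL // allrel_consl pairwise_cat /= allrel_consr.
have -> : all (fun z => ~~ (r x z && r z m)) R = all (fun z => ~~ r x z) R.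
  by apply: eq_in_all => z zR; rewrite (allP Rm _ zR) andbT.
case: (boolP (all (fun z => ~~ r x z) R)) => [/allP xR|_]; last by rewrite !andbF.
have -> : all (fun y => ~~ (r x m && r m y)) L.
  by apply/allP => y yL; rewrite (r_asym (allP Lm _ yL)) andbF.
have -> : allrel (fun y z => ~~ (r x z && r z y)) L R.
  by apply/allrelP => y z _ /xR /negbTE ->.
have -> : pairwise (fun y z => ~~ (r x z && r z y)) R.
  by apply: in_pairwise => y z _ /xR /negbTE ->.
by rewrite /= !andbT; case: (pairwise _ L); rewrite ?andbF.
Qed.

Lemma max_split_avoid132 L m R : uniq (L ++ m :: R) ->
  all (r^~ m) L -> all (r^~ m) R ->
  avoid132 r (L ++ m :: R) = [&& max_split r L m R, avoid132 r L & avoid132 r R].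
Proof.
move=> uLR Lm Rm; rewrite avoid132_cat // /max_split Lm Rm /=; congr (_ && _).
have LR x y : x \in L -> y \in R -> x != y.
  move: uLR; rewrite cat_uniq => /and3P[_ /hasPn nLR _] xL yR.
  by apply: contraTneq xL => ->; apply: nLR; rewrite inE yR orbT.
case: r_tot => _ _ tot.
rewrite allrelC; apply: eq_in_allrel (allss R) (allss L) => y x yR xL.
have /orP[xy|yx] := tot _ _ (LR _ _ xL yR); first by rewrite xy r_asym.
by rewrite yx r_asym.
Qed.

(** Since [R] lies below [L], its letters form an initial segment of the sorted alphabet, so the
    size of [R] alone determines both letter sets. *)
Lemma sorted_split T L R : sorted r T -> perm_eq (R ++ L) T -> allrel r R L ->
  perm_eq L (drop (size R) T) /\ perm_eq R (take (size R) T).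
Proof.
move=> sT pT RL; have uT := sorted_uniq r_trans r_irr sT.
have uRL : uniq (R ++ L) by rewrite (perm_uniq pT).
set R' := [seq x <- T | x \in R]; set L' := [seq x <- T | x \in L].
have memT x : (x \in T) = (x \in R) || (x \in L).
  by rewrite -(perm_mem pT) mem_cat.
have pR : perm_eq R R'.
  apply: uniq_perm; [by move: uRL; rewrite cat_uniq => /and3P[]|exact: filter_uniq|].
  by move=> x; rewrite mem_filter memT; case: (x \in R).
have pL : perm_eq L L'.
  apply: uniq_perm; [by move: uRL; rewrite cat_uniq => /and3P[]|exact: filter_uniq|].
  by move=> x; rewrite mem_filter memT; case: (x \in L); rewrite ?orbT.
have TE : T = R' ++ L'.
  apply: (irr_sorted_eq r_trans r_irr) => //.
    rewrite sorted_pairwise // pairwise_cat -!sorted_pairwise //.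
    rewrite !sorted_filter // !andbT.
    apply/allrelP => x y; rewrite -(perm_mem pR) -(perm_mem pL).
    by move/allrelP: RL; apply.
  by move=> x; rewrite memT mem_cat -(perm_mem pR) -(perm_mem pL).
by rewrite TE (perm_size pR) take_size_cat // drop_size_cat.
Qed.

(** The words correspond to triples: a size [k], a 132-avoiding arrangement of the [k] smallest
    letters to the right of [m], and one of the remaining letters to its left. *)
Lemma avoid132_perm T m : sorted r (rcons T m) ->
  perm_eq [seq s <- permutations (rcons T m) | avoid132 r s]
    [seq p.1 ++ m :: p.2 | k <- iota 0 (size T).+1,
       p <- [seq (L, R) | L <- [seq s <- permutations (drop k T) | avoid132 r s],
                          R <- [seq s <- permutations (take k T) | avoid132 r s]]].
Proof.
move=> sTm; have := sTm; rewrite sorted_pairwise // pairwise_rcons.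
case/andP=> Tm; rewrite -sorted_pairwise // => sT.
have uTm := sorted_uniq r_trans r_irr sTm.
have uT : uniq T by move: uTm; rewrite rcons_uniq => /andP[].
have mT : m \notin T by move: uTm; rewrite rcons_uniq => /andP[].
have split_mem L R : perm_eq (L ++ m :: R) (rcons T m) =
   perm_eq (R ++ L) T.
  rewrite -cat1s (perm_catCA L [:: m] R) perm_sym perm_rcons perm_sym /= perm_cons.
  by rewrite perm_catC.
(* The index of [m] is the length of the left part, so both words are cut at the same place. *)
have injLR L R L' R' : m \notin L -> m \notin L' ->
    L ++ m :: R = L' ++ m :: R' -> L = L' /\ R = R'.
  move=> mL mL' E; have: index m (L ++ m :: R) = index m (L' ++ m :: R') by rewrite E.
  rewrite !index_cat (negbTE mL) (negbTE mL') /= eqxx !addn0 => sz.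
  by move/eqP: E; rewrite eqseq_cat // eqseq_cons eqxx => /andP[/eqP -> /eqP ->].
apply: uniq_perm.
- by rewrite filter_uniq // permutations_uniq.
- apply: allpairs_uniq_dep; first exact: iota_uniq.
    move=> k _; apply: allpairs_uniq => [||[x1 x2] [y1 y2] _ _ //];
      by rewrite filter_uniq // permutations_uniq.
  move=> p p' /allpairsPdep[k [x [kT kx ->]]] /allpairsPdep[k' [x' [kT' kx' ->]]] /=.
  move: kx kx' => /allpairsP[[L R] /= [+ + ->]] /allpairsP[[L' R'] /= [+ + ->]] /=.
  rewrite !mem_filter !mem_permutations => /andP[_ pL] /andP[_ pR] /andP[_ pL'] /andP[_ pR'].
  have mL : m \notin L by rewrite (perm_mem pL); apply: contra mT; apply: mem_drop.
  have mL' : m \notin L' by rewrite (perm_mem pL'); apply: contra mT; apply: mem_drop.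
  move=> /(injLR _ _ _ _ mL mL')[LE RE].
  suff -> : k = k' by rewrite LE RE.
  move: kT kT'; rewrite !mem_iota /= !add0n !ltnS => kT kT'.
  by rewrite -(size_takel kT) -(size_takel kT') -(perm_size pR) -(perm_size pR') RE.
- move=> s; rewrite mem_filter mem_permutations; apply/andP/allpairsPdep.
    case=> av ps; have ms : m \in s by rewrite (perm_mem ps) mem_rcons inE eqxx.
    move: av ps; case/splitPr: ms => L R av ps.
    have us : uniq (L ++ m :: R) by rewrite (perm_uniq ps).
    have pT := ps; rewrite split_mem in pT.
    have Lm : all (r^~ m) L.
      by apply/allP => x xL; apply: (allP Tm); rewrite -(perm_mem pT) mem_cat xL orbT.
    have Rm : all (r^~ m) R.
      by apply/allP => x xR; apply: (allP Tm); rewrite -(perm_mem pT) mem_cat xR.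
    move: av; rewrite max_split_avoid132 // => /and3P[/and3P[_ _ RL] avL avR].
    have [pL pR] := sorted_split sT pT RL.
    exists (size R), (L, R); split => //.
      by rewrite mem_iota /= add0n ltnS -(perm_size pT) size_cat leq_addr.
    apply/allpairsP; exists (L, R).
    by rewrite /= !mem_filter !mem_permutations avL avR.
  case=> k [p [kT /allpairsP[[L R] /= [+ + ->]] ->]] /=.
  rewrite !mem_filter !mem_permutations => /andP[avL pL] /andP[avR pR].
  have pT : perm_eq (R ++ L) T by rewrite -(cat_take_drop k T) perm_cat.
  have ps : perm_eq (L ++ m :: R) (rcons T m) by rewrite split_mem.
  split=> //; rewrite max_split_avoid132 ?(perm_uniq ps) //; last 2 first.
  + by apply/allP => x xL; apply: (allP Tm); rewrite -(perm_mem pT) mem_cat xL orbT.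
  + by apply/allP => x xL; apply: (allP Tm); rewrite -(perm_mem pT) mem_cat xL.
  rewrite avL avR /max_split !andbT; apply/and3P; split.
  + by apply/allP => x xL; apply: (allP Tm); rewrite -(perm_mem pT) mem_cat xL orbT.
  + by apply/allP => x xL; apply: (allP Tm); rewrite -(perm_mem pT) mem_cat xL.
  apply/allrelP => x y; rewrite (perm_mem pR) (perm_mem pL).
  move: sT; rewrite -{1}(cat_take_drop k T) sorted_pairwise // pairwise_cat.
  by case/and3P=> /allrelP + _ _; apply.
Qed.

End MaxDecomposition.

(** * Order reversal and additivity of the statistics along the splitting *)

Definition flip (r : rel nat) : rel nat := fun x y => r y x.

Lemma flip_strict_total r : strict_total r -> strict_total (flip r).
Proof.
case=> tr ir tot; split; first by move=> y x z xy yz; apply: tr yz xy.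
  exact: ir.
by move=> x y xy; rewrite orbC; apply: tot.
Qed.

Lemma ltn_strict_total : strict_total ltn.
Proof.
split; [exact: ltn_trans|exact: ltnn|].
by move=> x y; rewrite neq_ltn.
Qed.

(** No letter from [m] on lies between two letters of [s1], so the only mixed occurrences use the
    adjacent pair formed by the last letter of [s1] and [m]; the middle term counts them. *)
Lemma vinc_cat (r : rel nat) s1 m s2 : irreflexive r ->
  {in s1 &, forall x y, {in m :: s2, forall c, ~~ (r y c && r c x)}} ->
  vinc r (s1 ++ m :: s2) = vinc r s1 +
    (if s1 is x :: s1' then count (fun c => r m c && r c (last x s1')) s2 else 0)
    + vinc r (m :: s2).
Proof.
move=> r_irr; elim: s1 => [//|x s1 IHs H].
rewrite [LHS]/= IHs; last first.
  by move=> a b a1 b1; apply: H; rewrite inE ?a1 ?b1 orbT.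
rewrite [vinc r (x :: s1)]/= !addnA; congr (_ + _).
case: s1 {IHs} H => [|y s1] H /=.
  by rewrite r_irr /= !addn0.
have -> : count (fun c => r y c && r c x) (s1 ++ m :: s2)
        = count (fun c => r y c && r c x) s1.
  rewrite count_cat -[RHS]addn0; congr addn; apply/eqP; rewrite -leqn0 leqNgt -has_count.
  by apply/hasPn => c cm; apply: H; rewrite ?inE ?eqxx ?orbT.
by rewrite !addnA.
Qed.

Section MaxSplitStatistics.

Variable r : rel nat.
Hypothesis r_tot : strict_total r.

Let r_trans : transitive r. Proof. by case: r_tot. Qed.
Let r_irr : irreflexive r. Proof. by case: r_tot. Qed.
Let r_asym x y : r x y -> r y x = false.
Proof. by move=> xy; apply/negP => /(r_trans xy); rewrite r_irr. Qed.

Variables (L R : seq nat) (m : nat).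
Hypothesis LmR : max_split r L m R.

Let Lm x : x \in L -> r x m. Proof. by case/and3P: LmR => /allP + _ _; apply. Qed.
Let Rm x : x \in R -> r x m. Proof. by case/and3P: LmR => _ /allP + _; apply. Qed.
Let RL x y : x \in R -> y \in L -> r x y.
Proof. by case/and3P: LmR => _ _ /allrelP; apply. Qed.

Let vinc_max s : {in s, forall x, r x m} ->
  vinc r (m :: s) = above_head r s + vinc r s.
Proof.
move=> sm /=; congr addn; case: s sm => // y s sm; rewrite /above_head.
by apply: eq_in_count => c cs; rewrite /= sm // andbT.
Qed.

(** The step into [m] is an ascent and contributes nothing; the step from [m] to the first letter of
    [R] encloses exactly the letters of [R] above that letter. *)
Lemma vinc_max_split :
  vinc r (L ++ m :: R) = vinc r L + vinc r R + above_head r R.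
Proof.
rewrite vinc_cat ?vinc_max //; last first.
  move=> x y xL yL c; rewrite inE => /orP[/eqP ->|cR].
    by rewrite (r_asym (Lm xL)) andbF.
  by rewrite (r_asym (RL cR yL)).
have -> : (if L is x :: s1' then
   count (fun c => r m c && r c (last x s1')) R else 0) = 0.
  case: L => // x s; apply/eqP; rewrite -leqn0 leqNgt -has_count.
  by apply/hasPn => c cR; rewrite (r_asym (Rm cR)).
by lia.
Qed.

(** In the reversed word [L] follows [m] and lies above [R], so no pair inside [R] encloses a later
    letter, and the step from [m] now leads to the last letter of [L]. *)
Lemma vinc_rev_max_split : vinc r (rev (L ++ m :: R))
  = vinc r (rev L) + vinc r (rev R) + above_head r (rev L).
Proof.
rewrite rev_cat rev_cons cat_rcons vinc_cat ?vinc_max //; last first.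
- by move=> x y; rewrite !mem_rev => xR yR c; rewrite inE mem_rev => /orP[/eqP ->|cL];
    rewrite ?(r_asym (Rm xR)) ?(r_asym (RL xR cL)) andbF.
- by move=> x; rewrite mem_rev; apply: Lm.
have -> : (if rev R is x :: s1' then
   count (fun c => r m c && r c (last x s1')) (rev L) else 0) = 0.
  case: (rev R) => // x s; apply/eqP; rewrite -leqn0 leqNgt -has_count.
  by apply/hasPn => c; rewrite mem_rev => cR; rewrite (r_asym (Lm cR)).
by rewrite addn0; lia.
Qed.

Lemma above_head_max_split :
  above_head r (L ++ m :: R) = if L is [::] then 0 else (above_head r L).+1.
Proof.
rewrite /above_head; move: Lm RL; case: L => [_ _|x s sm sR] /=.
  rewrite r_irr add0n; apply/eqP; rewrite -leqn0 leqNgt -has_count.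
  by apply/hasPn => c cR; rewrite (r_asym (Rm cR)).
rewrite r_irr !add0n count_cat /= sm ?inE ?eqxx // addnS.
have -> : count (r x) R = 0; last by rewrite addn0.
apply/eqP; rewrite -leqn0 leqNgt -has_count.
by apply/hasPn => c cR; rewrite r_asym // sR // inE eqxx.
Qed.

(** If [R] is nonempty, [m] and all of [L] lie above the last letter; otherwise the last letter is
    [m] itself. *)
Lemma above_last_max_split : above_head r (rev (L ++ m :: R))
  = if R is [::] then 0 else above_head r (rev R) + (size L).+1.
Proof.
rewrite rev_cat rev_cons cat_rcons /above_head.
have [E|[y [s E]]] : R = [::] \/ exists y s, R = rcons s y.
  by case: (lastP R) => [|s y]; [left|right; exists y, s].
  rewrite E /= r_irr add0n; apply/eqP; rewrite -leqn0 leqNgt -has_count.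
  by apply/hasPn => c; rewrite mem_rev => cL; rewrite (r_asym (Lm cL)).
have yR : y \in R by rewrite E mem_rcons inE eqxx.
have -> : rev R = y :: rev s by rewrite E rev_rcons.
rewrite /= r_irr !add0n count_cat /= (Rm yR) add1n.
have /eqP -> : count (r y) (rev L) == size (rev L).
  rewrite -all_count; apply/allP => x; rewrite mem_rev; exact: RL.
by rewrite size_rev E; case: (s).
Qed.

Lemma desc_max_split :
  desc r (L ++ m :: R) = desc r L + desc r R + (R != [::]).
Proof.
elim: L Lm => [_|x s IHs sm] /=.
  case: R Rm => [_|y t tm] /=; first by rewrite r_irr.
  by rewrite tm ?inE ?eqxx // add0n addnC.
rewrite IHs => [|y ys]; last by apply: sm; rewrite inE ys orbT.
rewrite -!addnA; congr addn; case: s {IHs} sm => //= sm.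
by rewrite r_irr r_asym // sm // inE.
Qed.

(** The letter [m] is a left-to-right maximum, so it needs a descent after it, that is, a nonempty
    [R]. For the last letter of [L], the following [m] acts like the convention that a final letter
    is followed by an ascent. *)
Lemma no_foremax_max_split :
  no_foremax r [::] (L ++ m :: R) = no_foremax r [::] L && (R != [::]).
Proof.
(* The prefix already read changes along the induction, but stays below [m]. *)
suff gen p : {in p, forall x, r x m} ->
    no_foremax r p (L ++ m :: R) = no_foremax r p L && (R != [::]) by exact: gen.
elim: L Lm p => [_|x s IHs sm] p pm /=; last first.
  rewrite IHs.
  - case: s {IHs} sm => [|y s] sm /=; last by rewrite !andbA.
    by rewrite sm ?inE ?eqxx ?andbT.
  - by move=> y ys; apply: sm; rewrite inE ys orbT.
  - by move=> y; rewrite inE => /orP[/eqP ->|/pm //]; apply: sm; rewrite inE eqxx.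
have -> : all (r^~ m) p by apply/allP.
(* Once [m] has been read, no later letter is a left-to-right maximum, so [R] imposes no further
   condition. *)
have nofm t u : m \in u -> {in t, forall x, r x m} -> no_foremax r u t.
  elim: t u => //= x t IHt u mu tm; rewrite IHt ?inE ?mu ?orbT // => [|y yt].
    by rewrite andbT negb_and; apply/orP; left; apply/allPn; exists m;
       rewrite // r_asym // tm // inE eqxx.
  by apply: tm; rewrite inE yt orbT.
rewrite nofm ?inE ?eqxx // andbT; case: R Rm => //= y t tm.
by rewrite r_asym // tm // inE eqxx.
Qed.

(** Every letter of [L] lies between [m] and the first letter of [R], so this single descent yields
    [size L] occurrences of 2-31. *)
Lemma vinc_flip_rev_max_split : vinc (flip r) (rev (L ++ m :: R))
  = vinc (flip r) (rev L) + vinc (flip r) (rev R)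
    + (if R is [::] then 0 else size L).
Proof.
rewrite rev_cat rev_cons cat_rcons.
have E : vinc (flip r) (m :: rev L) = vinc (flip r) (rev L).
  rewrite /= -[RHS]add0n; congr addn.
  apply/eqP; rewrite -leqn0 leqNgt -has_count; apply/hasPn => c.
  by rewrite mem_rev => cL; rewrite /flip (r_asym (Lm cL)) andbF.
have -> : (if R is [::] then 0 else size L) = if rev R is x :: s1' then
   count (fun c => flip r m c && flip r c (last x s1')) (rev L) else 0.
  case: (lastP R) RL => // s y RL'; rewrite rev_rcons.
  have -> : (if rcons s y is [::] then 0 else size L) = size L by case: (s).
  rewrite -(size_rev L); apply/esym/eqP; rewrite -all_count; apply/allP => c.
  rewrite mem_rev => cL; rewrite /flip Lm ?RL' // mem_rcons.
  by have := mem_last y (rev s); rewrite !inE mem_rev.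
rewrite vinc_cat //; last first.
  move=> x y; rewrite !mem_rev => xR yR c; rewrite inE mem_rev /flip => /orP[/eqP ->|cL].
    by rewrite (r_asym (Rm yR)).
  by rewrite (r_asym (RL yR cL)).
by rewrite E addnAC [vinc _ (rev R) + _]addnC.
Qed.

Lemma below_last_max_split : above_head (flip r) (rev (L ++ m :: R))
  = if R is [::] then size L else above_head (flip r) (rev R).
Proof.
rewrite rev_cat rev_cons cat_rcons /above_head /flip.
case: (lastP R) Rm RL => [_ _|s y Rm' RL'] /=.
  rewrite r_irr add0n -(size_rev L); apply/eqP; rewrite -all_count.
  by apply/allP => c; rewrite mem_rev; apply: Lm.
have yR : y \in rcons s y by rewrite mem_rcons inE eqxx.
rewrite rev_rcons count_cat /= (r_asym (Rm' _ yR)) add0n.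
have -> : count (r^~ y) (rev L) = 0.
  apply/eqP; rewrite -leqn0 leqNgt -has_count; apply/hasPn => c.
  by rewrite mem_rev => cL; rewrite (r_asym (RL' _ _ yR cL)).
by rewrite addn0; case: (s).
Qed.

(** The maximum has to be a peak, hence is preceded by an odd number of letters, unless it is the
    whole word. *)
Lemma zigzag_rev_max_split : zigzag r true (rev (L ++ m :: R)) =
  if odd (size R) then zigzag r true (rev L) && zigzag r true (rev R)
  else (L == [::]) && (R == [::]).
Proof.
have nilrev s : (rev s == [::]) = (s == [::] :> seq nat).
  by rewrite -!size_eq0 size_rev.
(* The expected direction alternates along the induction, so both directions are treated at once. *)
have gen A B up : {in A, forall x, r x m} -> {in B, forall x, r x m} ->
    zigzag r up (A ++ m :: B) = if odd (size A) == up
      then zigzag r up A && zigzag r true B else (A == [::]) && (B == [::]).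
  elim: A up => [|x A IHA] up Am Bm.
    by case: B Bm => [|y B] Bm; case: up => //=;
       rewrite ?(Bm y) ?(r_asym (Bm y _)) ?inE ?eqxx.
  rewrite [LHS]/= IHA // => [|y yA]; last by apply: Am; rewrite inE yA orbT.
  have xm : r x m by apply: Am; rewrite inE eqxx.
  case: A {IHA Am} => [|y A] /=.
    by case: up; rewrite /= ?xm ?(r_asym xm).
  by case: (odd _); case: up => //=; rewrite ?andbF ?andbA.
rewrite rev_cat rev_cons cat_rcons gen => [|x|x]; rewrite ?mem_rev; try by auto.
rewrite size_rev !nilrev [(R == _) && _]andbC eqb_id; case: ifP => // _.
by rewrite andbC.
Qed.

End MaxSplitStatistics.

(** * Weighted sums over 132-avoiding words *)

Local Open Scope ring_scope.

(** Course-of-values recursion: [pre n] lists the values at 0, ..., n, and longer lists agree with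
    shorter ones. *)
Lemma conv_rec_exists (K : comNzRingType) (G : nat -> nat -> K -> K -> K) (x0 : K) :
  exists a : nat -> K, a 0 = x0 /\
    forall n, a n.+1 = \sum_(k < n.+1) G (n - k)%N k (a (n - k)%N) (a k).
Proof.
pose fix pre n : seq K := if n is n'.+1 then
  rcons (pre n') (\sum_(k < n) G (n' - k)%N k (pre n')`_(n' - k) (pre n')`_k)
  else [:: x0].
have sz n : size (pre n) = n.+1 by elim: n => //= n IHn; rewrite size_rcons IHn.
have stable n k d : (k <= n)%N -> (pre (n + d)%N)`_k = (pre n)`_k.
  move=> kn; elim: d => [|d IHd]; first by rewrite addn0.
  by rewrite addnS /= nth_rcons sz ltnS (leq_trans kn (leq_addr _ _)).
exists (fun n => (pre n)`_n); split=> // n.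
rewrite /= nth_rcons sz ltnn eqxx; apply: eq_bigr => k _.
have kn : (k <= n)%N by rewrite -ltnS.
have get i : (i <= n)%N -> (pre n)`_i = (pre i)`_i.
  by move=> i_n; rewrite -{1}(subnKC i_n) stable.
by rewrite !get ?leq_subr.
Qed.

Definition wsum (K : comNzRingType) (r : rel nat) (T : seq nat)
    (Phi : seq nat -> K) : K :=
  \sum_(s <- permutations T | avoid132 r s) Phi s.

Section WeightedSums.

Variables (K : comNzRingType) (r : rel nat).
Hypothesis r_tot : strict_total r.
Implicit Types (Phi : seq nat -> K) (a : nat -> K) (c : nat -> nat -> K).

Let r_trans : transitive r. Proof. by case: r_tot. Qed.

Lemma wsum_nil Phi : wsum r [::] Phi = Phi [::].
Proof.
by rewrite /wsum (perm_big [:: [::]]) ?big_cons ?big_nil /= ?addr0.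
Qed.

(** The weights on the two sides may differ from [Phi]: a side can gain a statistic of its end
    letter or lose a condition. *)
Definition factors Phi c Phi1 Phi2 := forall L m R, max_split r L m R ->
  Phi (L ++ m :: R) = c (size L) (size R) * Phi1 L * Phi2 R.

Lemma wsum_rcons Phi c Phi1 Phi2 T m : factors Phi c Phi1 Phi2 ->
  sorted r (rcons T m) ->
  wsum r (rcons T m) Phi = \sum_(k < (size T).+1)
    c (size T - k)%N k * wsum r (drop k T) Phi1 * wsum r (take k T) Phi2.
Proof.
move=> PhiE sTm; rewrite /wsum -big_filter (perm_big _ (avoid132_perm r_tot sTm)).
rewrite big_allpairs_dep -[X in iota 0 X]subn0 -/(index_iota 0 _) big_mkord.
apply: eq_bigr => k _; rewrite big_allpairs /= -mulrA big_distrl mulr_sumr /=.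
rewrite [RHS]big_seq_cond [LHS]big_filter [LHS]big_seq_cond.
apply: eq_bigr => L; rewrite mem_permutations => /andP[pL _].
rewrite !mulr_sumr [RHS]big_seq_cond [LHS]big_filter [LHS]big_seq_cond.
apply: eq_bigr => R; rewrite mem_permutations => /andP[pR _].
have kT : (k <= size T)%N by rewrite -ltnS.
rewrite PhiE ?(perm_size pL) ?(perm_size pR) ?size_drop ?size_takel ?mulrA //.
move: sTm; rewrite sorted_pairwise // pairwise_rcons -{1 2}(cat_take_drop k T).
rewrite pairwise_cat all_cat => /and4P[/andP[/allP Rm /allP Lm] /allrelP RL _ _].
apply/and3P; split.
- by apply/allP => x; rewrite (perm_mem pL); apply: Lm.
- by apply/allP => x; rewrite (perm_mem pR); apply: Rm.
- by apply/allrelP => x y; rewrite (perm_mem pL) (perm_mem pR); apply: RL.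
Qed.

(** The induction hypothesis of [wsum_ind], named so that each side weight can be either [Phi]
    itself or a weight evaluated beforehand. *)
Definition wsum_upto Phi a n :=
  forall T, sorted r T -> (size T <= n)%N -> wsum r T Phi = a (size T).

Lemma wsum_ind Phi c Phi1 Phi2 a a1 a2 : factors Phi c Phi1 Phi2 ->
  a 0%N = Phi [::] ->
  (forall n, a n.+1 = \sum_(k < n.+1) c (n - k)%N k * a1 (n - k)%N * a2 k) ->
  (forall n, wsum_upto Phi a n -> wsum_upto Phi1 a1 n /\ wsum_upto Phi2 a2 n) ->
  forall T, sorted r T -> wsum r T Phi = a (size T).
Proof.
move=> PhiE a0 aS IH T sT; have [n] := ubnP (size T).
elim: n => // n IHn in T sT *; case/lastP: T sT => [_ _|T m sTm].
  by rewrite wsum_nil a0.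
rewrite size_rcons ltnS => Tn.
have [IH1 IH2] : wsum_upto Phi1 a1 (size T) /\ wsum_upto Phi2 a2 (size T).
  by apply: IH => T' sT' T'n; apply: IHn => //; apply: leq_ltn_trans Tn.
have sT : sorted r T by move: sTm; rewrite sorted_pairwise // pairwise_rcons
  => /andP[_]; rewrite -sorted_pairwise.
rewrite (wsum_rcons PhiE) // aS; apply: eq_bigr => k _.
have kT : (k <= size T)%N by rewrite -ltnS.
rewrite IH1 ?IH2 ?size_drop ?size_takel ?leq_subr //.
- exact: take_sorted.
- exact: drop_sorted.
Qed.

(** The sum depends on the alphabet only through its size. In the two variants that follow, only the
    left or only the right factor carries the same weight. *)
Lemma wsum_rec_exists Phi c : factors Phi c Phi Phi -> exists a,
  [/\ a 0%N = Phi [::],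
      forall n, a n.+1 = \sum_(k < n.+1) c (n - k)%N k * a (n - k)%N * a k
    & forall T, sorted r T -> wsum r T Phi = a (size T)].
Proof.
move=> PhiE; have [a [a0 aS]] := conv_rec_exists (fun j k x y => c j k * x * y) (Phi [::]).
by exists a; split=> //; apply: (wsum_ind PhiE).
Qed.

Lemma wsum_recl_exists Phi Phi2 c a2 : factors Phi c Phi Phi2 ->
  (forall T, sorted r T -> wsum r T Phi2 = a2 (size T)) -> exists a,
  [/\ a 0%N = Phi [::],
      forall n, a n.+1 = \sum_(k < n.+1) c (n - k)%N k * a (n - k)%N * a2 k
    & forall T, sorted r T -> wsum r T Phi = a (size T)].
Proof.
move=> PhiE W2.
have [a [a0 aS]] := conv_rec_exists (fun j k x y => c j k * x * a2 k) (Phi [::]).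
exists a; split=> //; apply: (wsum_ind PhiE) => // n IH.
by split=> // T sT _; apply: W2.
Qed.

Lemma wsum_recr_exists Phi Phi1 c a1 : factors Phi c Phi1 Phi ->
  (forall T, sorted r T -> wsum r T Phi1 = a1 (size T)) -> exists a,
  [/\ a 0%N = Phi [::],
      forall n, a n.+1 = \sum_(k < n.+1) c (n - k)%N k * a1 (n - k)%N * a k
    & forall T, sorted r T -> wsum r T Phi = a (size T)].
Proof.
move=> PhiE W1.
have [a [a0 aS]] := conv_rec_exists (fun j k x y => c j k * a1 j * y) (Phi [::]).
exists a; split=> //; apply: (wsum_ind PhiE) => // n IH.
by split=> // T sT _; apply: W1.
Qed.

(** * Multiplicativity of the weights *)

Variables t q : K.

Lemma factors_2_31 :
  let Phi s := t ^+ desc r s * q ^+ vinc (flip r) (rev s) in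
  factors Phi (fun j k => if k == 0%N then 1 else t * q ^+ j) Phi Phi.
Proof.
move=> Phi L m R LmR; rewrite /Phi desc_max_split // vinc_flip_rev_max_split //.
by case: R LmR => [|y R] _ /=; rewrite ?addn0 ?addn1 ?(exprD, exprS); ring.
Qed.

(** The factor [q ^+ j] has two sources: for nonempty [R] it comes from 2-31, for empty [R] from the
    letters of [L] below the final [m]. *)
Lemma factors_2_31_below_last :
  let Phi s := t ^+ desc r s * q ^+ vinc (flip r) (rev s) in
  let Psi s := Phi s * q ^+ above_head (flip r) (rev s) in
  factors Psi (fun j k => (if k == 0%N then 1 else t) * q ^+ j) Phi Psi.
Proof.
move=> Phi Psi L m R LmR; rewrite /Psi /Phi desc_max_split //.
rewrite vinc_flip_rev_max_split // below_last_max_split //.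
by case: R LmR => [|y R] _ /=; rewrite ?addn0 ?addn1 ?(exprD, exprS); ring.
Qed.

(** 2-13 contributes the number of letters above the last letter of [L], so recording this number
    makes the weight reproduce itself on both sides. *)
Lemma factors_2_13_above_last :
  let Phi s := t ^+ desc r s * q ^+ vinc r (rev s) in
  let Psi s := Phi s * q ^+ above_head r (rev s) in
  factors Psi (fun j k => if k == 0%N then 1 else t * q ^+ j.+1) Psi Psi.
Proof.
move=> Phi Psi L m R LmR; rewrite /Psi /Phi desc_max_split //.
rewrite vinc_rev_max_split // above_last_max_split //.
by case: R LmR => [|y R] _ /=; rewrite ?addn0 ?addn1 ?(exprD, exprS); ring.
Qed.

Lemma factors_2_13 :
  let Phi s := t ^+ desc r s * q ^+ vinc r (rev s) in
  let Psi s := Phi s * q ^+ above_head r (rev s) in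
  factors Phi (fun j k => if k == 0%N then 1 else t) Psi Phi.
Proof.
move=> Phi Psi L m R LmR; rewrite /Psi /Phi desc_max_split //.
rewrite vinc_rev_max_split //.
by case: R LmR => [|y R] _ /=; rewrite ?addn0 ?addn1 ?(exprD, exprS); ring.
Qed.

(** The coderangement condition passes to [L] only and forces [R] to be nonempty, whence the zero
    coefficient at [k = 0]. *)
Lemma factors_coder_2_31 :
  let Phi s := t ^+ desc r s * q ^+ vinc (flip r) (rev s) in
  let Psi s := (no_foremax r [::] s)%:R * Phi s in
  factors Psi (fun j k => if k == 0%N then 0 else t * q ^+ j) Psi Phi.
Proof.
move=> Phi Psi L m R LmR; rewrite /Psi /Phi desc_max_split //.
rewrite vinc_flip_rev_max_split // no_foremax_max_split //.
case: R LmR => [|y R] _ /=; rewrite ?andbF ?andbT ?addn0 ?addn1 ?(exprD, exprS) /=; ring.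
Qed.

(** The extra [q] for nonempty [L] records that [m] lies above the first letter. *)
Lemma factors_31_2_above_head :
  let Psi s := t ^+ desc r s * q ^+ (vinc r s + above_head r s) in
  factors Psi (fun j k => (if j == 0%N then 1 else q) * (if k == 0%N then 1 else t))
    Psi Psi.
Proof.
move=> Psi L m R LmR; rewrite /Psi desc_max_split //.
rewrite vinc_max_split // above_head_max_split //.
by case: L R LmR => [|x L] [|y R] _; rewrite /= ?addn0 ?addn1 ?addnS ?(exprD, exprS)
  ?exprD; ring.
Qed.

Lemma factors_coder_31_2 :
  let Psi s := t ^+ desc r s * q ^+ (vinc r s + above_head r s) in
  let Phi s := (no_foremax r [::] s)%:R * (t ^+ desc r s * q ^+ vinc r s) in
  factors Phi (fun j k => if k == 0%N then 0 else t) Phi Psi.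
Proof.
move=> Psi Phi L m R LmR; rewrite /Psi /Phi desc_max_split //.
rewrite vinc_max_split // no_foremax_max_split //.
case: R LmR => [|y R] _ /=; rewrite ?andbF ?andbT ?addn0 ?addn1 ?(exprD, exprS) /=; ring.
Qed.

Lemma factors_zigzag_2_31 :
  let Phi s := (zigzag r true (rev s))%:R * q ^+ vinc (flip r) (rev s) in
  factors Phi (fun j k => if odd k then q ^+ j else ((j == 0%N) && (k == 0%N))%:R)
    Phi Phi.
Proof.
move=> Phi L m R LmR; rewrite /Phi zigzag_rev_max_split //.
rewrite vinc_flip_rev_max_split //; case: ifP => [|_].
  by case: R LmR => // y R _ _; rewrite -mulnb natrM !exprD; ring.
by case: L R LmR => [|x L] [|y R] _; rewrite /= ?expr0; ring.
Qed.

Lemma factors_zigzag_31_2_above_head :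
  let Psi s := (zigzag r true (rev s))%:R * q ^+ (vinc r s + above_head r s) in
  factors Psi (fun j k => if odd k then (if j == 0%N then 1 else q)
                          else ((j == 0%N) && (k == 0%N))%:R) Psi Psi.
Proof.
move=> Psi L m R LmR; rewrite /Psi zigzag_rev_max_split //.
rewrite vinc_max_split // above_head_max_split //; case: ifP => [|_].
  by case: L R LmR => [|x L] [|y R] _ _ //; rewrite -mulnb natrM /= ?addn0 ?addnS
    ?(exprD, exprS); ring.
by case: L R LmR => [|x L] [|y R] _; rewrite /= ?expr0; ring.
Qed.

Lemma factors_zigzag_31_2 :
  let Psi s := (zigzag r true (rev s))%:R * q ^+ (vinc r s + above_head r s) in
  let Phi s := (zigzag r true (rev s))%:R * q ^+ vinc r s in
  factors Phi (fun j k => if odd k then 1 else ((j == 0%N) && (k == 0%N))%:R)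
    Phi Psi.
Proof.
move=> Psi Phi L m R LmR; rewrite /Psi /Phi zigzag_rev_max_split //.
rewrite vinc_max_split //; case: ifP => _.
  by rewrite -mulnb natrM !exprD; ring.
by case: L R LmR => [|x L] [|y R] _; rewrite /= ?expr0; ring.
Qed.

End WeightedSums.

(** * Closed forms of the recurrences *)

Lemma cf_coef_sqr (K : comNzRingType) (x : K) j :
  cf_coef x (x ^+ 2) j.+1 = x ^+ j.
Proof.
rewrite /cf_coef /= -exprM mul2n halfK; case: (boolP (odd j)) => jo /=.
  by rewrite -exprS subn1 prednK // odd_gt0.
by rewrite mul1r subn0.
Qed.

(** As [c_(j+1) = x^j], starting [j] levels deeper amounts to replacing z by [x^j] z, which
    multiplies the coefficient of [z^n] by [x^(jn)]. *)
Lemma cfrac_coef (K : comNzRingType) (x : K) (c : nat -> K) : c 0%N = 1 ->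
  (forall n, c n.+1 = \sum_(k < n.+1) x ^+ (n - k) * c (n - k)%N * c k) ->
  forall m d j n, (n <= d)%N -> (n < m)%N ->
    (cfrac x (x ^+ 2) m j.+1 d)`_n = x ^+ (j * n) * c n.
Proof.
move=> c0 cS m; elim=> [|d IHd] j.
  by case=> // _ _ /=; rewrite coef1 muln0 c0 mulr1.
rewrite [cfrac _ _ _ _ d.+1]/= cf_coef_sqr; set G' := cfrac _ _ _ _ _; set u := 'X * _.
set G := \sum_(i < m) _.
(* The truncated geometric series satisfies the exact equation up to [u ^+ m], which is divisible by
   ['X^m] and invisible in degree below [m]. *)
have GE : G = 1 + u * G - u ^+ m.
  by have := subrX1 u m; rewrite -/G mulrBl mul1r => /eqP; rewrite subr_eq => /eqP ->; ring.
elim/ltn_ind => -[|n] IHn nd nm; rewrite GE coefB coefD coef1 exprMn coefXnM nm subr0.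
  by rewrite -mulrA coefXM /= addr0 muln0 c0 mulr1.
rewrite add0r -mulrA coefXM /= -scalerAl coefZ coefMr cS !mulr_sumr.
apply: eq_bigr => k _; have kn : (k <= n)%N by rewrite -ltnS.
rewrite IHd ?IHn //; [|lia..].
rewrite (_ : (j * n.+1 = j + (j * (n - k) + j * k))%N); last first.
  by rewrite -mulnDr subnK // mulnS.
rewrite mulSn !exprD; ring.
Qed.

Lemma Cq_rec (K : comNzRingType) (x : K) : Cq 0 x = 1 /\
  forall n, Cq n.+1 x = \sum_(k < n.+1) x ^+ (n - k) * Cq (n - k) x * Cq k x.
Proof.
have [c [c0 cS]] := conv_rec_exists (fun j k a b => x ^+ j * a * b) (1 : K).
have CqE n : Cq n x = c n by rewrite /Cq /Ctq (cfrac_coef c0) // mul0n mul1r.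
by split=> [|n]; rewrite CqE // cS; apply: eq_bigr => k _; rewrite !CqE.
Qed.

Lemma sum_odd_support (K : comNzRingType) (F : nat -> K) m :
  (forall k, ~~ odd k -> F k = 0) ->
  \sum_(k < m.*2.+1) F k = \sum_(i < m) F i.*2.+1.
Proof.
move=> F0; elim: m => [|m IHm]; first by rewrite big_ord_recl !big_ord0 F0 ?addr0.
rewrite doubleS big_ord_recr /= F0 ?addr0; last by rewrite /= negbK odd_double.
by rewrite big_ord_recr /= IHm [RHS]big_ord_recr.
Qed.

(** The coefficients of A(xz), if [a] are those of A(z). *)
Definition twist (K : comNzRingType) (x : K) (a : nat -> K) n := x ^+ n * a n.

(** In series form, A(z) = z + y z A(xz) A(z). By parity only products of two odd-indexed terms
    survive, and they reproduce the recurrence of [Cq] at [x ^+ 2]. *)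
Lemma quadratic_rec (K : comNzRingType) (x y : K) (a : nat -> K) : a 0%N = 0 ->
  (forall n, a n.+1 = (n == 0%N)%:R
     + y * \sum_(k < n.+1) twist x a (n - k) * a k) ->
  forall n, a n = if odd n then (y * x) ^+ n./2 * Cq n./2 (x ^+ 2) else 0.
Proof.
move=> a0 aS; have [C0 CS] := Cq_rec (x ^+ 2); elim/ltn_ind => -[|n] IHn //.
have a_even k : (k <= n)%N -> ~~ odd k -> a k = 0.
  by move=> kn /negbTE ko; rewrite IHn ?ko.
rewrite aS /=; case: (boolP (odd n)) => no /=.
  rewrite big1 ?mulr0 ?addr0 => [|k _]; first by case: (n) no.
  have kn : (k <= n)%N by rewrite -ltnS.
  case: (boolP (odd k)) => ko; last by rewrite a_even ?mulr0.
  by rewrite /twist a_even ?leq_subr ?oddB ?no ?ko ?mulr0 ?mul0r.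
have := odd_double_half n; rewrite (negbTE no) add0n => nE.
rewrite -nE uphalf_double; case: (n./2) nE => [|m] nE.
  rewrite double0 big_ord_recl big_ord0 /twist a0 C0 /= expr0. ring.
(* Cut off above [n], because vanishing at even indices is known only up to there. *)
pose F k := if (k <= n)%N then twist x a (n - k) * a k else 0.
rewrite (eq_bigr (F \o @nat_of_ord _)) => [|k _]; last first.
  by rewrite /F /= -nE -ltnS ltn_ord.
rewrite [X in _ * X](sum_odd_support (F := F)); last first.
  by move=> k ko; rewrite /F; case: ifP => // kn; rewrite a_even ?mulr0.
rewrite doubleS /= add0r CS !mulr_sumr; apply: eq_bigr => i _.
have im : (i <= m)%N by rewrite -ltnS.
have -> : F i.*2.+1 = twist x a (m - i).*2.+1 * a i.*2.+1.
  by rewrite /F ifT; [congr (twist _ _ _ * _)|]; lia.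
rewrite /twist !IHn; [|lia..]; rewrite /= !odd_double /= !uphalf_double.
have -> : (y * x) ^+ m.+1 = y * x * ((y * x) ^+ i * (y * x) ^+ (m - i)).
  by rewrite -exprD subnKC // exprS.
by rewrite -exprM mul2n exprS; ring.
Qed.

(** * Truncated formal power series *)

(* A formal power series is handled through its truncations [\poly_(i < N) a i];
   [low0 N p] says that [p] vanishes modulo ['X^N]. *)
Definition low0 (K : comNzRingType) N (p : {poly K}) :=
  forall i, (i < N)%N -> p`_i = 0.

Section Truncation.

Variables (K : comNzRingType) (N : nat).
Implicit Types (p : {poly K}) (a b c : nat -> K).

Lemma low0D p1 p2 : low0 N p1 -> low0 N p2 -> low0 N (p1 + p2).
Proof. by move=> h1 h2 i iN; rewrite coefD h1 ?h2 ?addr0. Qed.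

Lemma low0Ml p1 p2 : low0 N p2 -> low0 N (p1 * p2).
Proof.
move=> h i iN; rewrite coefMr big1 // => k _.
by rewrite h ?mulr0 // (leq_trans _ iN).
Qed.

Definition scaleX (x : K) p := p \Po (x *: 'X).

Lemma coef_scaleX x p i : (scaleX x p)`_i = x ^+ i * p`_i.
Proof.
rewrite /scaleX comp_polyE coef_sum; under eq_bigr => k _ do
  rewrite exprZn coefZ coefZ coefXn.
case: (ltnP i (size p)) => ip; last first.
  rewrite big1 ?nth_default ?mulr0 // => k _.
  by rewrite gtn_eqF ?mulr0 // (leq_trans _ ip).
rewrite (bigD1 (Ordinal ip)) //= eqxx mulr1 big1 ?addr0 1?mulrC // => k.
by rewrite -val_eqE eq_sym /= => /negbTE ->; rewrite !mulr0.
Qed.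

Lemma low0_scaleX x p : low0 N p -> low0 N (scaleX x p).
Proof. by move=> h i iN; rewrite coef_scaleX h ?mulr0. Qed.

Definition trunc a : {poly K} := \poly_(i < N) a i.

Lemma scaleX_trunc x a : scaleX x (trunc a) = trunc (twist x a).
Proof.
by apply/polyP => i; rewrite coef_scaleX !coef_poly; case: ifP; rewrite ?mulr0.
Qed.

(** Two products are allowed so that the exceptional coefficient at [k = 0] can be split off from
    the generic one. *)
Lemma trunc_conv a b c b' c' :
  (forall n, a n.+1 = \sum_(k < n.+1) (b (n - k)%N * c k + b' (n - k)%N * c' k)) ->
  low0 N (trunc a - ((a 0%N)%:P
    + 'X * (trunc b * trunc c + trunc b' * trunc c'))).
Proof.
move=> aS [|n] nN; rewrite coefB coefD coefC coefXM coef_poly nN /=.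
  by rewrite addr0 subrr.
rewrite add0r aS coefD !coefMr -big_split /=; apply/eqP; rewrite subr_eq0; apply/eqP.
apply: eq_bigr => k _; rewrite !coef_poly.
have kn : (k <= n)%N by rewrite -ltnS.
by rewrite !ifT //; lia.
Qed.

End Truncation.

Lemma quadratic_rec_of_trunc (K : comNzRingType) (x y : K) (a : nat -> K) :
  (forall N, low0 N.+1 (trunc N.+1 a
     - ('X + y%:P * 'X * (trunc N.+1 (twist x a) * trunc N.+1 a)))) ->
  forall n, a n = if odd n then (y * x) ^+ n./2 * Cq n./2 (x ^+ 2) else 0.
Proof.
move=> aP; apply: quadratic_rec => [|n].
  have := aP 0%N 0%N isT; rewrite coefB coefD -mulrA coefCM coefXM coefX !coef_poly /=.
  by rewrite mulr0 addr0 subr0.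
have := aP n.+1 n.+1 (ltnSn _); rewrite coefB coefD -mulrA coefCM coefXM coefX.
rewrite coef_poly ltnSn eqSS => /eqP; rewrite subr_eq0 => /eqP ->; congr (_ + _ * _).
rewrite coefMr; apply: eq_bigr => k _; rewrite !coef_poly.
have kn : (k <= n)%N by rewrite -ltnS.
by rewrite !ifT //; lia.
Qed.

(** * Functional equations and their solutions *)

Section ClosedForms.

Variable K : comNzRingType.
Implicit Types (q t : K) (a f : nat -> K).

Let delta (k : nat) : K := (k == 0%N)%:R.

Let trunc_delta N : trunc N.+1 delta = 1.
Proof.
apply/polyP => i; rewrite coef_poly coef1 /delta.
by case: ltnP => //; case: i.
Qed.

Let trunc_subdelta N a : trunc N.+1 (fun k => a k - delta k) = trunc N.+1 a - 1.
Proof.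
rewrite -(trunc_delta N); apply/polyP => i; rewrite coefB !coef_poly.
by case: ifP; rewrite ?subrr.
Qed.

Let trunc_scale N t a : trunc N (fun k => t * a k) = t%:P * trunc N a.
Proof.
by apply/polyP => i; rewrite coefCM !coef_poly; case: ifP; rewrite ?mulr0.
Qed.

Let scaleXE q :
  (forall p1, scaleX q (- p1) = - scaleX q p1) *
  (forall p1 p2, scaleX q (p1 + p2) = scaleX q p1 + scaleX q p2) *
  (forall p1 p2, scaleX q (p1 * p2) = scaleX q p1 * scaleX q p2) *
  (forall c, scaleX q c%:P = c%:P) * (scaleX q 1 = 1) * (scaleX q 'X = q%:P * 'X).
Proof.
rewrite /scaleX; do ![split] => *.
- exact: raddfN.
- exact: comp_polyD.
- exact: comp_polyM.
- exact: comp_polyC.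
- exact: comp_polyC.
- by rewrite comp_polyX mul_polyC.
Qed.

Let trunc_2_31 q t f : f 0%N = 1 ->
  (forall n, f n.+1 = \sum_(k < n.+1)
     (if (k : nat) == 0%N then 1 else t * q ^+ (n - k)) * f (n - k)%N * f k) ->
  forall N, low0 N.+1 (trunc N.+1 f - (1 + 'X * (trunc N.+1 f
     + t%:P * scaleX q (trunc N.+1 f) * (trunc N.+1 f - 1)))).
Proof.
move=> f0 fS N.
have := @trunc_conv _ N.+1 f f delta (fun k => t * twist q f k) (fun k => f k - delta k).
rewrite f0 trunc_delta mulr1 trunc_subdelta trunc_scale -scaleX_trunc; apply=> n.
rewrite fS; apply: eq_bigr => k _; rewrite /delta /twist.
by case: eqP => [->|_] /=; rewrite ?f0; ring.
Qed.

(** For t = -1 the functional equation of F is literally the quadratic equation of F - 1 with y = -1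
    and x = q. *)
Lemma closed_2_31 q f : f 0%N = 1 ->
  (forall n, f n.+1 = \sum_(k < n.+1)
     (if (k : nat) == 0%N then 1 else -1 * q ^+ (n - k)) * f (n - k)%N * f k) ->
  forall n, f n - (n == 0%N)%:R
    = if odd n then (-1 * q) ^+ n./2 * Cq n./2 (q ^+ 2) else 0.
Proof.
move=> f0 fS; apply: (quadratic_rec_of_trunc (a := fun n => f n - delta n)) => N.
rewrite -scaleX_trunc trunc_subdelta !scaleXE ?polyC1; set F := trunc _ _; set F' := scaleX _ _.
suff -> : F - 1 - ('X + (-1)%:P * 'X * ((F' - 1) * (F - 1)))
  = F - (1 + 'X * (F + (-1)%:P * F' * (F - 1))).
  exact: trunc_2_31.
rewrite polyCN; ring.
Qed.

(** Here P = 1 + z(P - q P(qz)(P - 1)) and F = 1 + z(P - P(F - 1)); eliminating P leaves the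
    quadratic equation for F - 1. *)
Lemma closed_2_13 q p f : p 0%N = 1 -> f 0%N = 1 ->
  (forall n, p n.+1 = \sum_(k < n.+1)
     (if (k : nat) == 0%N then 1 else -1 * q ^+ (n - k).+1) * p (n - k)%N * p k) ->
  (forall n, f n.+1 = \sum_(k < n.+1)
     (if (k : nat) == 0%N then 1 else -1) * p (n - k)%N * f k) ->
  forall n, f n - (n == 0%N)%:R
    = if odd n then (-1 * q) ^+ n./2 * Cq n./2 (q ^+ 2) else 0.
Proof.
move=> p0 f0 pS fS; apply: (quadratic_rec_of_trunc (a := fun n => f n - delta n)) => N.
rewrite -scaleX_trunc trunc_subdelta !scaleXE ?polyC1.
have: low0 N.+1 (trunc N.+1 p - (1 + 'X * (trunc N.+1 p
     + (-1 * q)%:P * scaleX q (trunc N.+1 p) * (trunc N.+1 p - 1)))).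
  apply: trunc_2_31 => // n; rewrite pS; apply: eq_bigr => k _.
  by rewrite exprS mulrA.
have: low0 N.+1 (trunc N.+1 f - (1 + 'X * (trunc N.+1 p
     + (-1)%:P * trunc N.+1 p * (trunc N.+1 f - 1)))).
  have := @trunc_conv _ N.+1 f p delta (fun k => -1 * p k) (fun k => f k - delta k).
  rewrite f0 trunc_delta mulr1 trunc_subdelta trunc_scale; apply=> n.
  rewrite fS; apply: eq_bigr => k _; rewrite /delta.
  by case: eqP => [->|_] /=; rewrite ?f0; ring.
move: (trunc _ p) (trunc _ f) => P F e2 e1; have := low0_scaleX q e2; rewrite !scaleXE ?polyC1.
move: (scaleX q P) (scaleX q F) e1 => P' F' e1 e2'.
set e := (X in low0 _ X).
(* With A = F - 1, the second equation reads zP(1 - A) = A, and likewise for its dilation.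
   Multiplying the equation of P by z(1 - A)(1 - A(qz)) therefore removes P and P(qz); the other two
   cofactors account for these substitutions. *)
have -> : e = 'X * (1 - (F - 1)) * (1 - (F' - 1))
      * (P - (1 + 'X * (P + (-1 * q)%:P * P' * (P - 1))))
    + (1 - 'X + 'X * (F' - 1)
         - (F' - (1 + q%:P * 'X * (P' + (-1)%:P * P' * (F' - 1)))))
      * (F - (1 + 'X * (P + (-1)%:P * P * (F - 1))))
    + (F - 1 - 'X * (1 - (F - 1)))
      * (F' - (1 + q%:P * 'X * (P' + (-1)%:P * P' * (F' - 1)))).
  by rewrite /e !polyCM polyCN; ring.
by do 2?[apply: low0D]; apply: low0Ml.
Qed.

(** With t = -q, the equation of E is E - 1 = z F(qz)(1 - q(E - 1)), so F(qz) can be eliminated from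
    the dilated equation of F. *)
Lemma closed_2_31_below_last q f e : f 0%N = 1 -> e 0%N = 1 ->
  (forall n, f n.+1 = \sum_(k < n.+1)
     (if (k : nat) == 0%N then 1 else - q * q ^+ (n - k)) * f (n - k)%N * f k) ->
  (forall n, e n.+1 = \sum_(k < n.+1)
     (if (k : nat) == 0%N then 1 else - q) * q ^+ (n - k) * f (n - k)%N * e k) ->
  forall n, e n - (n == 0%N)%:R
    = if odd n then (- q ^+ 2 * q) ^+ n./2 * Cq n./2 (q ^+ 2) else 0.
Proof.
move=> f0 e0 fS eS; apply: (quadratic_rec_of_trunc (a := fun n => e n - delta n)) => N.
rewrite -scaleX_trunc trunc_subdelta !scaleXE ?polyC1.
have := trunc_2_31 f0 fS (N := N).
have: low0 N.+1 (trunc N.+1 e - (1 + 'X * (scaleX q (trunc N.+1 f)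
     + (- q)%:P * scaleX q (trunc N.+1 f) * (trunc N.+1 e - 1)))).
  have := @trunc_conv _ N.+1 e (twist q f) delta (fun k => - q * twist q f k)
    (fun k => e k - delta k).
  rewrite e0 trunc_delta mulr1 trunc_subdelta trunc_scale -scaleX_trunc; apply=> n.
  rewrite eS; apply: eq_bigr => k _; rewrite /delta /twist.
  by case: eqP => [->|_] /=; rewrite ?e0; ring.
move: (trunc _ f) (trunc _ e) => F E e2 e1.
have := low0_scaleX q e2; have := low0_scaleX q e1; rewrite !scaleXE ?polyC1.
move: (scaleX q F) e2 {e1} => F' e2.
move: (scaleX q F') (scaleX q E) => F'' E' e1' e2'.
set g := (X in low0 _ X).
(* Elimination of F(qz) and F(q^2 z), using the equation of E, its dilation and the dilated equation
   of F. *)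
have -> : g = 'X * (1 - q%:P * (E - 1)) * ((1 - q%:P * (E' - 1))
        * (F' - (1 + q%:P * 'X * (F' + (- q)%:P * F'' * (F' - 1))))
      + q%:P * (F' - 1)
        * (E' - (1 + q%:P * 'X * (F'' + (- q)%:P * F'' * (E' - 1)))))
    + (1 - q%:P * 'X + q%:P ^+ 2 * 'X * (E' - 1))
      * (E - (1 + 'X * (F' + (- q)%:P * F' * (E - 1)))).
  by rewrite /g !polyCN rmorphXn /=; ring.
apply: low0D; apply: low0Ml => //.
by apply: low0D; apply: low0Ml.
Qed.

(** With A = E - 1 the equation becomes A = z(1 + qA)(1 - qA), that is, A = z - q^2 z A^2; the [Cq]
    at 1 are the Catalan numbers. *)
Lemma closed_31_2_above_head q e : e 0%N = 1 ->
  (forall n, e n.+1 = \sum_(k < n.+1) (if (n - k == 0)%N then 1 else q)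
     * (if (k : nat) == 0%N then 1 else - q) * e (n - k)%N * e k) ->
  forall n, e n - (n == 0%N)%:R
    = if odd n then (- q ^+ 2 * 1) ^+ n./2 * Cq n./2 (1 ^+ 2) else 0.
Proof.
move=> e0 eS; apply: (quadratic_rec_of_trunc (a := fun n => e n - delta n)) => N.
have -> : trunc N.+1 (twist 1 (fun n => e n - delta n)) = trunc N.+1 e - 1.
  rewrite -trunc_subdelta; apply/polyP => i; rewrite !coef_poly /twist expr1n.
  by rewrite mul1r.
rewrite trunc_subdelta.
(* Since [e 0 = 1], the left coefficient (1 for j = 0, q otherwise) times [e j] is
   [q * e j + (1 - q) * delta j]. *)
have := @trunc_conv _ N.+1 e (fun j => q * e j + (1 - q) * delta j) delta
  (fun j => - q * (q * e j + (1 - q) * delta j)) (fun k => e k - delta k).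
have E1 : trunc N.+1 (fun j => q * e j + (1 - q) * delta j)
    = q%:P * trunc N.+1 e + (1 - q)%:P.
  rewrite -[in RHS](mulr1 (1 - q)%:P) -(trunc_delta N) -!trunc_scale.
  by apply/polyP => i; rewrite coefD !coef_poly; case: ifP; rewrite ?addr0.
rewrite e0 trunc_delta mulr1 trunc_subdelta trunc_scale E1 => H.
suff: low0 N.+1 (trunc N.+1 e - (1%:P + 'X * (q%:P * trunc N.+1 e + (1 - q)%:P
   + (- q)%:P * (q%:P * trunc N.+1 e + (1 - q)%:P) * (trunc N.+1 e - 1)))).
  move: (trunc _ _) => E; set g1 := (X in low0 _ X); set g2 := (X in _ -> low0 _ X).
  suff -> : g1 = g2 by [].
  by rewrite /g1 /g2 !(polyCN, polyCB) rmorphXn /=; ring.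
apply: H => n; rewrite eS; apply: eq_bigr => k _; rewrite /delta.
by case: eqP => [->|_]; case: eqP => [->|_] /=; rewrite ?e0; ring.
Qed.

(** For even [n] and odd [k] the index [n - k] is odd, so the odd-indexed values satisfy the
    quadratic recurrence among themselves. *)
Lemma closed_zigzag_odd (x y : K) (g : nat -> K) a : a 0%N = 1 ->
  (forall j, odd j -> g j = y * x ^+ j) ->
  (forall n, a n.+1 = \sum_(k < n.+1) (if odd k then g (n - k)%N
     else ((n - k == 0)%N && ((k : nat) == 0%N))%:R) * a (n - k)%N * a k) ->
  forall n, odd n -> a n = (y * x) ^+ n./2 * Cq n./2 (x ^+ 2).
Proof.
move=> a0 gE aS n no; pose b n := if odd n then a n else 0.
have -> : a n = b n by rewrite /b no.
rewrite (@quadratic_rec _ x y b) ?no // => {}n {no}; rewrite /b /=.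
case: (boolP (odd n)) => no /=.
  rewrite big1 => [|k _]; first by case: (n) no => // m _; rewrite mulr0 addr0.
  have kn : (k <= n)%N by rewrite -ltnS.
  rewrite /twist oddB // no; case: (odd k) => /=; by rewrite ?(mulr0, mul0r).
have -> : (n == 0%N)%:R = \sum_(k < n.+1) ((n == 0%N) && ((k : nat) == 0%N))%:R :> K.
  rewrite big_ord_recl /= andbT big1 ?addr0 // => k _.
  by rewrite andbF.
rewrite aS mulr_sumr -big_split /=; apply: eq_bigr => k _.
have kn : (k <= n)%N by rewrite -ltnS.
rewrite /twist oddB // (negbTE no); case: (boolP (odd k)) => ko /=.
  rewrite gE ?oddB ?(negbTE no) ?ko // (_ : (k : nat) == 0%N = false) ?andbF.
    by rewrite add0r !mulrA.
  by case: (k : nat) ko.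
case: (eqVneq (k : nat) 0%N) => [k0|_]; last by rewrite !andbF /=; ring.
by rewrite k0 subn0; case: (eqVneq n 0%N) => [->|_]; rewrite ?a0 /=; ring.
Qed.

(** Only odd [k] contribute, leaving an even left part, and the exponents of [w] add up: 1 + (n -
    k)/2 + (k - 1)/2 = (n + 1)/2. *)
Lemma coder_zigzag_even (x w : K) (d e a b : nat -> K) : d 0%N = 1 -> a 0%N = 1 ->
  (forall n, d n.+1 = \sum_(k < n.+1)
     (if (k : nat) == 0%N then 0 else w * x ^+ (n - k)) * d (n - k)%N * e k) ->
  (forall n, a n.+1 = \sum_(k < n.+1) (if odd k then x ^+ (n - k)
     else ((n - k == 0)%N && ((k : nat) == 0%N))%:R) * a (n - k)%N * b k) ->
  (forall k, e k.+1 = if odd k then 0 else w ^+ k./2 * b k.+1) ->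
  forall n, d n = if odd n then 0 else w ^+ n./2 * a n.
Proof.
move=> d0 a0 dS aS eE; elim/ltn_ind => -[|n] IHn; first by rewrite d0 a0 mulr1.
rewrite dS /=; case: (boolP (odd n)) => no /=; last first.
  rewrite big1 // => -[[|k] /= kn] _; first by rewrite !mul0r.
  rewrite eE; case: (boolP (odd k)) => ko; first by rewrite mulr0.
  by rewrite IHn ?oddB ?(negbTE no) /= ?ko ?mulr0 ?mul0r //; lia.
rewrite aS mulr_sumr; apply: eq_bigr => -[[|k] /= kn] _.
  by rewrite subn0 andbT; case: (n) no => //= m _; ring.
rewrite eE; case: (boolP (odd k)) => ko; first by rewrite !andbF !mulr0 mul0r mul0r mulr0.
rewrite IHn ?oddB ?no /= ?ko; [|lia..].
have -> : w ^+ (uphalf n) = w * (w ^+ (n - k.+1)./2 * w ^+ k./2).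
  by rewrite -exprD -exprS; congr (_ ^+ _); lia.
rewrite /=; ring.
Qed.

End ClosedForms.

(** * From permutations to words *)

Lemma desc_rev r s : irreflexive r -> desc r (rev s) = desc (flip r) s.
Proof.
move=> r_irr.
have desc_rcons u x : desc r (rcons u x) = (desc r u + r x (last x u))%N.
  elim: u => [|y u IHu] /=; first by rewrite r_irr.
  by rewrite IHu addnA; case: u {IHu} => [|z u] /=; rewrite ?r_irr ?addn0.
elim: s => //= x s IHs; rewrite rev_cons desc_rcons IHs addnC.
by case: s {IHs} => //= y s; rewrite rev_cons last_rcons.
Qed.

(** Each adjacent pair of distinct letters is a descent for exactly one of [r] and [flip r]. *)
Lemma desc_flip r s : strict_total r -> uniq s ->
  (desc r s + desc (flip r) s = (size s).-1)%N.
Proof.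
move=> rT; have [r_trans r_irr tot] := rT.
elim: s => // x s IHs /andP[xs us]; case: s xs us IHs => [|y s] xs us IHs.
  by rewrite /= /flip r_irr.
have {}IHs := IHs us; rewrite [desc r _]/= [desc (flip r) _]/= [size _]/=.
rewrite [(size (y :: s)).-1]/= in IHs.
have /tot : x != y by apply: contraNneq xs => ->; rewrite inE eqxx.
have : ~~ (r x y && r y x) by apply/negP => /andP[/r_trans /[apply]]; rewrite r_irr.
move: IHs; rewrite /= /flip; case: (r x y); case: (r y x) => //=; lia.
Qed.

Lemma count_nth (P : pred nat) x0 s :
  count P s = (\sum_(i < size s) P (nth x0 s i))%N.
Proof.
elim: s => [|x s IHs]; first by rewrite big_ord0.
by rewrite /= big_ord_recl IHs.
Qed.

Lemma vinc_nth r x0 s : irreflexive r ->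
  vinc r s = (\sum_(i < size s) \sum_(j < size s) [&& i.+1 < j,
    r (nth x0 s i.+1) (nth x0 s j) & r (nth x0 s j) (nth x0 s i)])%N.
Proof.
move=> r_irr; elim: s => [|x s IHs]; first by rewrite big_ord0.
rewrite [LHS]/= IHs big_ord_recl big_ord_recl [size _]/= add0n; congr addn.
  rewrite (count_nth _ x0); apply: eq_bigr => -[[|j] js] _ /=; last first.
    by case: s {IHs} js.
  by case: s {IHs} js => //= y s _; rewrite r_irr.
by apply: eq_bigr => i _; rewrite [RHS]big_ord_recl add0n; apply: eq_bigr.
Qed.

Lemma vinc_rev_nth r x0 s : irreflexive r ->
  vinc r (rev s) = (\sum_(i < size s) \sum_(j < size s) [&& j < i, i.+1 < size s,
    r (nth x0 s i) (nth x0 s j) & r (nth x0 s j) (nth x0 s i.+1)])%N.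
Proof.
move=> r_irr; rewrite (vinc_nth x0) // size_rev.
case sz : (size s) => [|m]; first by rewrite !big_ord0.
(* The last position starts no adjacent pair; without it, the reversal acts on [m] starting
   positions for [i] but on [m + 1] positions for [j]. *)
rewrite big_ord_recr [RHS]big_ord_recr /=; congr addn; last first.
  rewrite !big1 // => j _; first by rewrite ltnn andbF.
  by rewrite ltnNge (ltnW (ltn_ord j)).
rewrite [LHS](reindex_inj rev_ord_inj) /=; apply: eq_bigr => i _.
rewrite [LHS](reindex_inj rev_ord_inj) /=; apply: eq_bigr => j _.
have im := ltn_ord i; have jm := ltn_ord j.
rewrite !subSS ltnS im /=.
have -> : ((m - i.+1).+1 < m - j)%N = (j < i)%N by lia.
case: ltnP => //= ji; rewrite !nth_rev ?sz; [|lia..].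
by congr (nat_of_bool (r (nth _ _ _) (nth _ _ _) && r (nth _ _ _) (nth _ _ _))); lia.
Qed.

Lemma desc_nth r x0 s : irreflexive r ->
  desc r s = (\sum_(i < size s)
    ((i.+1 < size s) && r (nth x0 s i.+1) (nth x0 s i)))%N.
Proof.
move=> r_irr; elim: s => [|x s IHs]; first by rewrite big_ord0.
rewrite /= big_ord_recl IHs /=; congr addn; case: s {IHs} => //=.
by rewrite r_irr.
Qed.

Lemma avoid132P (r : rel nat) x0 s :
  reflect (forall i j k, (i < j)%N -> (j < k)%N -> (k < size s)%N ->
             ~~ (r (nth x0 s i) (nth x0 s k) && r (nth x0 s k) (nth x0 s j)))
    (avoid132 r s).
Proof.
elim: s => [|x s IHs] /=; first by apply: ReflectT.
apply: (iffP andP) => [[/(pairwiseP x0) xs /IHs sP] [|i] [|j] [|k] //|H].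
- by move=> _ jk ks; apply: (xs j k (ltn_trans (jk : (j < k)%N) ks) ks jk).
- by move=> ij jk ks; apply: (sP i j k).
split; last by apply/IHs => i j k; apply: (H i.+1 j.+1 k.+1).
by apply/(pairwiseP x0) => j k js ks jk; apply: (H 0%N j.+1 k.+1).
Qed.

Lemma avoid132_revP (r : rel nat) x0 s :
  reflect (forall i j k, (i < j)%N -> (j < k)%N -> (k < size s)%N ->
             ~~ (r (nth x0 s k) (nth x0 s i) && r (nth x0 s i) (nth x0 s j)))
    (avoid132 r (rev s)).
Proof.
have nthE i : (i < size s)%N -> nth x0 s i = nth x0 (rev s) (size s - i.+1).
  by move=> si; rewrite nth_rev; [congr nth; lia|lia].
apply: (iffP (avoid132P r x0 _)) => H i j k ij jk ks.
  by rewrite !nthE; [|lia..]; apply: H; rewrite ?size_rev; lia.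
rewrite size_rev in ks; rewrite !nth_rev; [|lia..]; apply: H; lia.
Qed.

Lemma zigzagP (r : rel nat) x0 (up : bool) s :
  reflect (forall i, (i.+1 < size s)%N -> if odd i == up
     then r (nth x0 s i.+1) (nth x0 s i) else r (nth x0 s i) (nth x0 s i.+1))
    (zigzag r up s).
Proof.
elim: s up => [|x s IHs] up /=; first by apply: ReflectT.
apply: (iffP andP) => [[xs /IHs sP] [|i]|H].
- by case: s xs {IHs sP} => //= y s; case: up.
- by rewrite ltnS => /sP {xs sP}; rewrite /=; case: (odd i); case: up.
split; first by case: s H {IHs} => //= y s /(_ 0%N isT); case: up.
by apply/IHs => i si; have := H i.+1 si; rewrite {H} /=; case: (odd i); case: up.
Qed.

Lemma no_foremaxP (r : rel nat) x0 p s :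
  reflect (forall i, (i < size s)%N ->
     ~~ [&& all (r^~ (nth x0 s i)) p, all (r^~ (nth x0 s i)) (take i s) &
            (i.+1 < size s)%N ==> r (nth x0 s i) (nth x0 s i.+1)])
    (no_foremax r p s).
Proof.
elim: s p => [|x s IHs] p /=; first by apply: ReflectT.
apply: (iffP andP) => [[xs /IHs sP] [|i]|H].
- by move=> _ /=; case: s xs {IHs sP}.
- by rewrite ltnS => /sP; apply: contra => /=; rewrite ltnS => /and3P[-> /andP[-> ->] ->].
split; first by have := H 0%N isT; case: s {H IHs}.
apply/IHs => i si; apply: contra (H i.+1 si) => /=.
by rewrite ltnS => /and3P[/andP[-> ->] -> ->].
Qed.

(** * Permutations as words and the translation of their statistics *)

Definition word n (s : 'S_n) : seq nat := [seq val (s i) | i <- enum 'I_n].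

Lemma size_word n (s : 'S_n) : size (word s) = n.
Proof. by rewrite size_map size_enum_ord. Qed.

Lemma nth_word n (s : 'S_n) x0 (i : 'I_n) : nth x0 (word s) i = s i.
Proof. by rewrite (nth_map i) ?size_enum_ord // nth_ord_enum. Qed.

Lemma word_inj n : injective (@word n).
Proof.
move=> s s' E; apply/permP => i; apply: val_inj.
by rewrite /= -(nth_word s 0) E nth_word.
Qed.

Lemma word_perm n (s : 'S_n) : perm_eq (word s) (iota 0 n).
Proof.
have us : uniq (word s).
  by rewrite map_inj_uniq ?enum_uniq // => i j /val_inj /perm_inj.
apply: uniq_perm => //; first exact: iota_uniq.
have [] // := uniq_min_size us (s2 := iota 0 n); last by rewrite size_word size_iota.
by move=> x /mapP[i _ ->]; rewrite mem_iota /=.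
Qed.

(** The map [word] is injective and both sides range over n! objects. *)
Lemma sum_word (K : comNzRingType) n (P : pred (seq nat)) (F : seq nat -> K) :
  \sum_(s : 'S_n | P (word s)) F (word s) =
  \sum_(w <- permutations (iota 0 n) | P w) F w.
Proof.
rewrite -(big_map (@word n) P F); apply: perm_big.
have uw : uniq [seq word s | s <- index_enum 'S_n].
  by rewrite map_inj_uniq ?index_enum_uniq //; apply: word_inj.
apply: uniq_perm => //; first exact: permutations_uniq.
have [] // := uniq_min_size uw (s2 := permutations (iota 0 n)).
  by move=> w /mapP[s _ ->]; rewrite mem_permutations word_perm.
rewrite size_permutations ?iota_uniq // size_iota size_map -card_Sn cardT.
by rewrite enumT.
Qed.

Lemma sum_rev_permutations (K : comNzRingType) T (P : pred (seq nat)) (F : seq nat -> K) :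
  \sum_(w <- permutations T | P w) F w =
  \sum_(w <- permutations T | P (rev w)) F (rev w).
Proof.
rewrite -(big_map rev P F); apply: perm_big; apply: uniq_perm.
- exact: permutations_uniq.
- by rewrite map_inj_uniq ?permutations_uniq //; apply: inv_inj revK.
move=> w; rewrite -{2}(revK w) mem_map; last exact: inv_inj revK.
by rewrite !mem_permutations perm_rev.
Qed.

Lemma card_sum_nat (T : finType) (P : pred T) :
  #|[set x | P x]| = (\sum_x P x)%N.
Proof.
rewrite cardsE -sum1_card big_mkcond; apply: eq_bigr => x _.
by rewrite unfold_in; case: (P x).
Qed.

(** Reading positions with default [n] reproduces [pv] exactly. *)
Lemma st31_2E n (s : 'S_n) : st31_2 s = vinc ltn (word s).
Proof.
rewrite (vinc_nth n); last exact: ltnn.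
by rewrite size_word pair_bigA /st31_2 card_sum_nat.
Qed.

Lemma st13_2E n (s : 'S_n) : st13_2 s = vinc (flip ltn) (word s).
Proof.
rewrite (vinc_nth n); last exact: ltnn.
rewrite size_word pair_bigA /st13_2 card_sum_nat; apply: eq_bigr => p _.
by rewrite /flip [X in _ && X]andbC.
Qed.

Lemma st2_13E n (s : 'S_n) : st2_13 s = vinc ltn (rev (word s)).
Proof.
rewrite (vinc_rev_nth n); last exact: ltnn.
by rewrite size_word pair_bigA /st2_13 card_sum_nat.
Qed.

Lemma st2_31E n (s : 'S_n) : st2_31 s = vinc (flip ltn) (rev (word s)).
Proof.
rewrite (vinc_rev_nth n); last exact: ltnn.
rewrite size_word pair_bigA /st2_31 card_sum_nat; apply: eq_bigr => p _.
by rewrite /flip [(pv s p.1.+1 < _)%N && _]andbC.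
Qed.

Lemma desE n (s : 'S_n) : des s = desc ltn (word s).
Proof.
rewrite (desc_nth n); last exact: ltnn.
by rewrite size_word /des card_sum_nat.
Qed.

Lemma alternatingE n (s : 'S_n) : alternating s = zigzag ltn true (word s).
Proof.
apply/forallP/(zigzagP _ n) => [H i|H i]; rewrite ?size_word.
  move=> si; have := H (Ordinal (ltnW si)); rewrite /= si /=.
  by rewrite eqb_id.
apply/implyP => si; have := H i; rewrite size_word eqb_id => /(_ si).
by [].
Qed.

Lemma coderangementE n (s : 'S_n) : coderangement s = no_foremax ltn [::] (word s).
Proof.
(* The values are distinct, so the weak maximum over positions up to [i] is a strict one over the
   earlier positions. *)
have take_word (i : 'I_n) : all (ltn^~ (s i)) (take i (word s))
    = [forall j : 'I_n, (j <= i)%N ==> (s j <= s i)%N].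
  apply/(all_nthP 0%N)/forallP => [H j|H j].
    apply/implyP; rewrite leq_eqVlt => /orP[/eqP/val_inj -> //|ji].
    have := H j; rewrite size_take size_word ltn_ord => /(_ ji).
    by rewrite nth_take // nth_word => /ltnW.
  rewrite size_take size_word ltn_ord => ji; rewrite nth_take //.
  have jn := ltn_trans ji (ltn_ord i); have := H (Ordinal jn).
  rewrite /= (ltnW ji) /= leq_eqVlt => /orP[/eqP/val_inj/perm_inj E|].
    by move: ji; rewrite -E /= ltnn.
  by rewrite -(nth_word s 0).
(* Past the end [pv] returns [n], larger than every letter, so the last position always counts as an
   ascent. *)
have next (i : 'I_n) : (pv s i < pv s i.+1)%N
    = ((i.+1 < n)%N ==> (nth n (word s) i < nth n (word s) i.+1)%N).
  rewrite /pv -/(word s); case: (ltnP i.+1 n) => //= ni.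
  by rewrite nth_word [nth n _ _]nth_default ?size_word // (ltn_ord (s i)).
apply/forallP/(no_foremaxP _ n) => [H i|H i]; rewrite ?size_word.
  move=> si; have := H (Ordinal si); apply: contra => /= /andP[lr up].
  by rewrite /foremax next -take_word -(nth_word s n (Ordinal si)) /= lr up.
have := H i; rewrite size_word => /(_ (ltn_ord i)); apply: contra.
by rewrite /foremax next -take_word nth_word => /andP[-> ->].
Qed.

Lemma avoids3P n (s : 'S_n) a b c :
  reflect (forall i j k : 'I_n, (i < j)%N -> (j < k)%N -> ~~ [&&
      (s i < s j)%N == (a < b)%N, (s i < s k)%N == (a < c)%N,
      (s j < s k)%N == (b < c)%N, (s j < s i)%N == (b < a)%N,
      (s k < s i)%N == (c < a)%N & (s k < s j)%N == (c < b)%N])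
    (avoids s [:: a; b; c]).
Proof.
apply: (iffP negP) => [H i j k ij jk|H /existsP[f /forallP fP]].
  apply/negP => /and5P[/eqP e1 /eqP e2 /eqP e3 /eqP e4 /andP[/eqP e5 /eqP e6]].
  apply: H; apply/existsP; exists [ffun x : 'I_3 => nth i [:: i; j; k] x].
  apply/forallP => x; apply/forallP => y; rewrite !ffunE.
  case: x => -[|[|[|//]]] /= _; case: y => -[|[|[|//]]] /= _;
    by rewrite ?e1 ?e2 ?e3 ?e4 ?e5 ?e6 ?ltnn ?eqxx ?ij ?jk ?(ltn_trans ij jk).
pose o0 : 'I_3 := @Ordinal 3 0 isT; pose o1 : 'I_3 := @Ordinal 3 1 isT.
pose o2 : 'I_3 := @Ordinal 3 2 isT.
have E (x y : 'I_3) : ((x < y)%N ==> (f x < f y)%N)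
  /\ (s (f x) < s (f y))%N = (nth 0 [:: a; b; c] x < nth 0 [:: a; b; c] y)%N.
  by move: (fP x) => /forallP /(_ y) /andP[-> /eqP].
have /negP := H (f o0) (f o1) (f o2) (proj1 (E o0 o1)) (proj1 (E o1 o2)).
by rewrite (proj2 (E o0 o1)) (proj2 (E o0 o2)) (proj2 (E o1 o2))
  (proj2 (E o1 o0)) (proj2 (E o2 o0)) (proj2 (E o2 o1)) /= !eqxx.
Qed.

(** On distinct letters the six comparisons defining a pattern collapse to a shorter condition [Q],
    which can be matched with [avoid132]. *)
Lemma avoids_wordE n (s : 'S_n) a b c (Q : nat -> nat -> nat -> bool) :
  (forall x y z, x != y -> x != z -> y != z -> [&&
      (x < y)%N == (a < b)%N, (x < z)%N == (a < c)%N,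
      (y < z)%N == (b < c)%N, (y < x)%N == (b < a)%N,
      (z < x)%N == (c < a)%N & (z < y)%N == (c < b)%N] = Q x y z) ->
  avoids s [:: a; b; c] <->
  (forall i j k, (i < j)%N -> (j < k)%N -> (k < size (word s))%N ->
     ~~ Q (nth 0 (word s) i) (nth 0 (word s) j) (nth 0 (word s) k)).
Proof.
move=> QE; have neq (i j : 'I_n) : (i < j)%N -> s i != s j :> nat.
  by move=> ij; rewrite val_eqE (inj_eq perm_inj) -val_eqE neq_ltn ij.
split=> [/avoids3P H i j k ij jk|H].
  rewrite size_word => kn; have jn := ltn_trans jk kn; have i_n := ltn_trans ij jn.
  rewrite (nth_word s 0 (Ordinal i_n)) (nth_word s 0 (Ordinal jn)).
  rewrite (nth_word s 0 (Ordinal kn)) -QE; first exact: H.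
  - exact: neq.
  - by apply: neq; apply: ltn_trans jk.
  - exact: neq.
apply/avoids3P => i j k ij jk; rewrite QE ?neq ?(ltn_trans ij jk) //.
by rewrite -!(nth_word s 0); apply: H; rewrite ?size_word.
Qed.

Lemma avoids132E n (s : 'S_n) : avoids s [:: 1; 3; 2]%N = avoid132 ltn (word s).
Proof.
have H := @avoids_wordE _ s 1 3 2 (fun x y z => (x < z)%N && (z < y)%N).
apply/idP/(avoid132P _ 0); apply H => x y z;
  by case: (ltngtP x y) => //; case: (ltngtP x z) => //; case: (ltngtP y z) => //=; lia.
Qed.

Lemma avoids312E n (s : 'S_n) :
  avoids s [:: 3; 1; 2]%N = avoid132 (flip ltn) (word s).
Proof.
have H := @avoids_wordE _ s 3 1 2 (fun x y z => (z < x)%N && (y < z)%N).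
apply/idP/(avoid132P _ 0); apply H => x y z;
  by case: (ltngtP x y) => //; case: (ltngtP x z) => //; case: (ltngtP y z) => //=; lia.
Qed.

Lemma avoids213E n (s : 'S_n) :
  avoids s [:: 2; 1; 3]%N = avoid132 (flip ltn) (rev (word s)).
Proof.
have H := @avoids_wordE _ s 2 1 3 (fun x y z => (x < z)%N && (y < x)%N).
apply/idP/(avoid132_revP _ 0); apply H => x y z;
  by case: (ltngtP x y) => //; case: (ltngtP x z) => //; case: (ltngtP y z) => //=; lia.
Qed.

Lemma avoids231E n (s : 'S_n) :
  avoids s [:: 2; 3; 1]%N = avoid132 ltn (rev (word s)).
Proof.
have H := @avoids_wordE _ s 2 3 1 (fun x y z => (z < x)%N && (x < y)%N).
apply/idP/(avoid132_revP _ 0); apply H => x y z;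
  by case: (ltngtP x y) => //; case: (ltngtP x z) => //; case: (ltngtP y z) => //=; lia.
Qed.

(** * The signed sums *)

Section SignedSums.

Variables (K : comNzRingType) (q : K) (r : rel nat) (T : seq nat).
Hypotheses (r_tot : strict_total r) (sT : sorted r T).

Lemma wsum_des_2_31 : (0 < size T)%N ->
  wsum r T (fun s => (-1) ^+ desc r s * q ^+ vinc (flip r) (rev s))
  = if odd (size T) then (- q) ^+ (size T)./2 * Cq (size T)./2 (q ^+ 2) else 0.
Proof.
move=> T0; have [f [f0 fS ->]] := wsum_rec_exists r_tot (factors_2_31 r_tot (-1) q); last by [].
have := closed_2_31 _ fS (size T); rewrite f0 mulr1 => /(_ erefl).
by rewrite gtn_eqF // subr0 mulN1r.
Qed.

Lemma wsum_des_2_13 : (0 < size T)%N ->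
  wsum r T (fun s => (-1) ^+ desc r s * q ^+ vinc r (rev s))
  = if odd (size T) then (- q) ^+ (size T)./2 * Cq (size T)./2 (q ^+ 2) else 0.
Proof.
move=> T0.
have [p [p0 pS pE]] := wsum_rec_exists r_tot (factors_2_13_above_last r_tot (-1) q).
have [f [f0 fS ->]] := wsum_recr_exists r_tot (factors_2_13 r_tot (-1) q) pE; last by [].
have := closed_2_13 _ _ pS fS (size T); rewrite p0 f0 !mulr1 => /(_ erefl erefl).
by rewrite gtn_eqF // subr0 mulN1r.
Qed.

Lemma wsum_des_2_31_below_last : (0 < size T)%N ->
  wsum r T (fun s => (- q) ^+ desc r s * q ^+ vinc (flip r) (rev s)
                     * q ^+ above_head (flip r) (rev s))
  = if odd (size T)
    then (- q ^+ 3) ^+ (size T)./2 * Cq (size T)./2 (q ^+ 2) else 0.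
Proof.
move=> T0.
have [f [f0 fS fE]] := wsum_rec_exists r_tot (factors_2_31 r_tot (- q) q).
have [e [e0 eS ->]] := wsum_recr_exists r_tot (factors_2_31_below_last r_tot (- q) q) fE;
  last by [].
have := closed_2_31_below_last _ _ fS eS (size T).
rewrite f0 e0 !mulr1 => /(_ erefl erefl).
by rewrite gtn_eqF // subr0 mulNr -exprSr.
Qed.

(** The part right of the maximum carries the full signed 2-31 sum, which at odd size equals a sign
    times the zigzag sum and at positive even size vanishes; so the two recurrences agree up to
    sign. *)
Lemma wsum_coder_2_31 :
  wsum r T (fun s => (no_foremax r [::] s)%:R
                     * ((-1) ^+ desc r s * q ^+ vinc (flip r) (rev s)))
  = if odd (size T) then 0 else (-1) ^+ (size T)./2
    * wsum r T (fun s => (zigzag r true (rev s))%:R * q ^+ vinc (flip r) (rev s)).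
Proof.
have [f [f0 fS fE]] := wsum_rec_exists r_tot (factors_2_31 r_tot (-1) q).
have [d [d0 dS ->]] := wsum_recl_exists r_tot (factors_coder_2_31 r_tot (-1) q) fE; last by [].
have [a [a0 aS ->]] := wsum_rec_exists r_tot (factors_zigzag_2_31 r_tot q); last by [].
rewrite /= !mulr1 in f0 d0 a0.
apply: (coder_zigzag_even d0 a0 dS aS) => k.
have := closed_2_31 f0 fS k.+1; rewrite subr0 => ->.
case: (boolP (odd k)) => ko; rewrite /= ko //=.
rewrite (@closed_zigzag_odd _ q 1 _ a a0 _ aS) ?mul1r //= => [|j _].
  by rewrite uphalf_half (negbTE ko) add0n exprMn mulrA.
by rewrite mul1r.
Qed.

Lemma wsum_coder_31_2 :
  wsum r T (fun s => (no_foremax r [::] s)%:R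
                     * ((- q) ^+ desc r s * q ^+ vinc r s))
  = if odd (size T) then 0 else (- q) ^+ (size T)./2
    * wsum r T (fun s => (zigzag r true (rev s))%:R * q ^+ vinc r s).
Proof.
have [e [e0 eS eE]] := wsum_rec_exists r_tot (factors_31_2_above_head r_tot (- q) q).
have [d [d0 dS ->]] := wsum_recl_exists r_tot (factors_coder_31_2 r_tot (- q) q) eE; last by [].
have [b [b0 bS bE]] := wsum_rec_exists r_tot (factors_zigzag_31_2_above_head r_tot q).
have [a [a0 aS ->]] := wsum_recl_exists r_tot (factors_zigzag_31_2 r_tot q) bE; last by [].
rewrite /= !mulr1 in e0 d0 a0 b0.
apply: (@coder_zigzag_even _ 1 (- q) d e a b d0 a0) => [n|n|k].
- by rewrite dS; apply: eq_bigr => k _; rewrite expr1n mulr1.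
- by rewrite aS; apply: eq_bigr => k _; rewrite expr1n.
have := closed_31_2_above_head e0 eS k.+1; rewrite subr0 => ->.
case: (boolP (odd k)) => ko; rewrite /= ko //=.
(* Here [x = 1] and [y = q]: the closed forms have bases [- q ^+ 2] and [q], whose ratio is
   [- q]. *)
rewrite (@closed_zigzag_odd _ 1 q (fun j => if j == 0%N then 1 else q) b b0 _ bS) //= => [|[|j] // _].
  by rewrite uphalf_half (negbTE ko) add0n !mulr1 expr2 -mulNr exprMn mulrA.
by rewrite expr1n mulr1.
Qed.

End SignedSums.

(** * Reduction of the permutation sums to weighted sums *)

Lemma rev_iota_sorted n : sorted (flip ltn) (rev (iota 0 n)).
Proof. by rewrite rev_sorted; apply: iota_ltn_sorted. Qed.

Lemma wsum_perm (K : comNzRingType) r T T' (Phi : seq nat -> K) : perm_eq T T' ->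
  wsum r T Phi = wsum r T' Phi.
Proof. by move=> TT'; apply: perm_big; apply: perm_permutations. Qed.

Lemma eq_wsum (K : comNzRingType) r T (Phi Psi : seq nat -> K) :
  (forall s, perm_eq s T -> Phi s = Psi s) -> wsum r T Phi = wsum r T Psi.
Proof.
move=> E; rewrite /wsum big_seq_cond [RHS]big_seq_cond; apply: eq_bigr => s.
by rewrite mem_permutations => /andP[/E].
Qed.

Lemma sum_avoid132_rev (K : comNzRingType) r n (F : seq nat -> K) :
  \sum_(w <- permutations (iota 0 n) | avoid132 r (rev w)) F w
  = wsum r (rev (iota 0 n)) (fun w => F (rev w)).
Proof.
rewrite sum_rev_permutations; under eq_bigl do rewrite revK.
by apply: wsum_perm; rewrite perm_sym perm_rev.
Qed.

Lemma big_indicator (K : comNzRingType) (I : Type) (s : seq I) (P Q : pred I)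
    (F : I -> K) :
  \sum_(i <- s | P i && Q i) F i = \sum_(i <- s | Q i) (P i)%:R * F i.
Proof.
under eq_bigl do rewrite andbC; rewrite big_mkcondr; apply: eq_bigr => i _.
by case: (P i); rewrite ?mul1r ?mul0r.
Qed.
Lemma cons_max_split n u : perm_eq u (iota 0 n) -> max_split ltn [::] n u.
Proof.
move=> pu; rewrite /max_split /= allrel0r andbT; apply/allP => x.
by rewrite (perm_mem pu) mem_iota add0n.
Qed.

(* The first letter of a word is always a left-to-right maximum, so a coderangement
   starts with a descent; avoiding 213 then forces that letter to be the maximum. *)
Lemma sum_coder213 (K : comNzRingType) n (F : seq nat -> K) : (0 < n)%N ->
  \sum_(w <- permutations (iota 0 n.+1) |
      no_foremax ltn [::] w && avoid132 (flip ltn) (rev w)) F w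
  = \sum_(w <- permutations (iota 0 n) | avoid132 (flip ltn) (rev w)) F (n :: w).
Proof.
move=> n0; rewrite -big_filter.
rewrite -[RHS]big_filter -(big_map (cons n) xpredT F); apply: perm_big.
have perm_cons_max w : perm_eq (n :: w) (iota 0 n.+1) = perm_eq w (iota 0 n).
  by rewrite -addn1 iotaD cats1 add0n perm_sym perm_rcons perm_cons perm_sym.
apply: uniq_perm.
- by rewrite filter_uniq // permutations_uniq.
- by rewrite map_inj_uniq ?filter_uniq ?permutations_uniq // => u v [].
move=> w; rewrite mem_filter mem_permutations; apply/andP/mapP => [[/andP[nf av] pw]|].
  have := perm_size pw; rewrite size_iota.
  case: w => [//|a [|b w]] in nf av pw * => [[E]|_]; first by rewrite -E in n0.
  have uw : uniq [:: a, b & w] by rewrite (perm_uniq pw) iota_uniq.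
  have le_n x : x \in [:: a, b & w] -> (x <= n)%N.
    by rewrite (perm_mem pw) mem_iota add0n ltnS.
  (* Otherwise the first letter would be a foremaximum. *)
  have ba : (b < a)%N.
    move: nf uw => /= /andP[nab _] /andP[]; rewrite inE negb_or => /andP[ab _] _.
    by rewrite ltn_neqAle eq_sym ab leqNgt.
  (* If not, [n] stands after [b], and [a], [b], [n] form a 213. *)
  have an : a = n.
    apply/eqP; rewrite eqn_leq le_n ?inE ?eqxx //= leqNgt; apply/negP => an.
    have : n \in [:: a, b & w] by rewrite (perm_mem pw) mem_iota add0n leqnn.
    rewrite !inE (gtn_eqF an) (gtn_eqF (ltn_trans ba an)) /= => nw.
    have /avoid132_revP/(_ 0%N 1%N (index n w).+2 isT isT) := av.
    move=> /(_ 0%N); rewrite /= !ltnS index_mem => /(_ nw).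
    by rewrite /flip /= nth_index // an ba.
  exists (b :: w); last by rewrite an.
  rewrite mem_filter mem_permutations -perm_cons_max -{1}an pw andbT.
  by apply/(avoid132_revP _ 0) => i j k; apply: (avoid132_revP _ 0 _ av i.+1 j.+1 k.+1).
case=> u; rewrite mem_filter mem_permutations => /andP[av pu ->].
have un x : x \in u -> (x < n)%N by rewrite (perm_mem pu) mem_iota add0n.
rewrite perm_cons_max; split=> //; apply/andP; split.
  have := @no_foremax_max_split _ ltn_strict_total [::] u n; rewrite /= => ->.
    by rewrite -size_eq0 (perm_size pu) size_iota -lt0n.
  exact: cons_max_split.
apply/(avoid132_revP _ 0) => -[|i] [|j] [|k] // ij jk ks.
  by rewrite /flip /= ltnNge ltnW // un // mem_nth.
exact: (avoid132_revP _ 0 _ av i j k).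
Qed.

Lemma desc_cons_max n u : perm_eq u (iota 0 n.+1) ->
  desc ltn (n.+1 :: u) = (desc ltn u).+1.
Proof.
move=> pu; have := desc_max_split ltn_strict_total (cons_max_split pu).
by rewrite /= => ->; rewrite add0n -size_eq0 (perm_size pu) size_iota addn1.
Qed.

(** This extra term is why (vii) needs the series that also records an end letter. *)
Lemma vinc_cons_max n u : perm_eq u (iota 0 n) ->
  vinc ltn (n :: u) = (vinc ltn u + above_head ltn u)%N.
Proof.
by move=> pu; have := vinc_max_split ltn_strict_total (cons_max_split pu).
Qed.

Lemma vinc_flip_cons_max n u : perm_eq u (iota 0 n) ->
  vinc (flip ltn) (n :: u) = vinc (flip ltn) u.
Proof.
move=> pu; rewrite /= -[RHS]add0n; congr addn; apply/eqP.
rewrite -leqn0 leqNgt -has_count; apply/hasPn => c.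
by rewrite (perm_mem pu) mem_iota add0n /flip => /ltnW; rewrite leqNgt => /negbTE /= ->; rewrite andbF.
Qed.

(** Reversal turns 231 into 132, while the up-down condition and the statistic are still read on the
    original word, that is, on [rev s]. *)
Lemma Chat_wsum m : Chat m = wsum ltn (iota 0 (2 * m))
  (fun s => (zigzag ltn true (rev s))%:R * 'X ^+ vinc (flip ltn) (rev s)).
Proof.
rewrite /Chat; under eq_bigr do rewrite st13_2E.
under eq_bigl do rewrite alternatingE avoids231E.
rewrite (sum_word _ (fun w => zigzag ltn true w && avoid132 ltn (rev w))
  (fun w => 'X ^+ vinc (flip ltn) w)).
rewrite big_indicator sum_avoid132_rev; apply: wsum_perm.
by rewrite perm_rev.
Qed.

Lemma Cbar_wsum m : Cbar m = wsum ltn (iota 0 (2 * m))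
  (fun s => (zigzag ltn true (rev s))%:R * 'X ^+ vinc ltn s).
Proof.
rewrite /Cbar; under eq_bigr do rewrite st2_13E.
under eq_bigl do rewrite alternatingE avoids231E.
rewrite (sum_word _ (fun w => zigzag ltn true w && avoid132 ltn (rev w))
  (fun w => 'X ^+ vinc ltn (rev w))).
rewrite big_indicator sum_avoid132_rev; under eq_wsum do rewrite revK.
by apply: wsum_perm; rewrite perm_rev.
Qed.

Lemma wsumZ (K : comNzRingType) r T (c : K) (Phi : seq nat -> K) :
  wsum r T (fun w => c * Phi w) = c * wsum r T Phi.
Proof. by rewrite /wsum mulr_sumr. Qed.

Section PermutationSums.

Variables (K : comNzRingType) (n : nat) (x q : K) (st : 'S_n -> nat).

Lemma sum_des_132 (v : seq nat -> nat) : (forall s, st s = v (word s)) ->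
  \sum_(s : 'S_n | avoids s [:: 1; 3; 2]%N) x ^+ des s * q ^+ st s
  = wsum ltn (iota 0 n) (fun w => x ^+ desc ltn w * q ^+ v w).
Proof.
move=> stE; under eq_bigl do rewrite avoids132E.
under eq_bigr do rewrite desE stE.
by rewrite (sum_word _ _ (fun w => x ^+ desc ltn w * q ^+ v w)).
Qed.

Lemma sum_des_213 (v : seq nat -> nat) : (forall s, st s = v (rev (word s))) ->
  \sum_(s : 'S_n | avoids s [:: 2; 1; 3]%N) x ^+ des s * q ^+ st s
  = wsum (flip ltn) (rev (iota 0 n))
      (fun w => x ^+ desc (flip ltn) w * q ^+ v w).
Proof.
move=> stE; under eq_bigl do rewrite avoids213E.
under eq_bigr do rewrite desE stE.
rewrite (sum_word _ (fun w => avoid132 (flip ltn) (rev w))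
  (fun w => x ^+ desc ltn w * q ^+ v (rev w))) sum_avoid132_rev.
by apply: eq_wsum => w _; rewrite revK desc_rev //; apply: ltnn.
Qed.

(* Complementing turns [des] into [n - 1 - des]. *)
Lemma sum_sign_312 (v : seq nat -> nat) : (forall s, st s = v (word s)) ->
  \sum_(s : 'S_n | avoids s [:: 3; 1; 2]%N) (-1) ^+ des s * q ^+ st s
  = (-1) ^+ n.-1 * wsum (flip ltn) (rev (iota 0 n))
      (fun w => (-1) ^+ desc (flip ltn) w * q ^+ v w).
Proof.
move=> stE; under eq_bigl do rewrite avoids312E.
under eq_bigr do rewrite desE stE.
rewrite (sum_word _ _ (fun w => (-1) ^+ desc ltn w * q ^+ v w)) -wsumZ.
rewrite [LHS](@wsum_perm _ _ _ (rev (iota 0 n))); last by rewrite perm_sym perm_rev.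
apply: eq_wsum => w pw.
have uw : uniq w by rewrite (perm_uniq pw) rev_uniq iota_uniq.
have := desc_flip ltn_strict_total uw; rewrite (perm_size pw) size_rev size_iota => <-.
by rewrite exprD -mulrA [X in _ = _ * X]mulrA -expr2 sqrr_sign mul1r.
Qed.

Lemma sum_coder_132 (v : seq nat -> nat) : (forall s, st s = v (word s)) ->
  \sum_(s : 'S_n | coderangement s && avoids s [:: 1; 3; 2]%N)
     x ^+ des s * q ^+ st s
  = wsum ltn (iota 0 n) (fun w => (no_foremax ltn [::] w)%:R
      * (x ^+ desc ltn w * q ^+ v w)).
Proof.
move=> stE; under eq_bigl do rewrite coderangementE avoids132E.
under eq_bigr do rewrite desE stE.
rewrite (sum_word _ (fun w => no_foremax ltn [::] w && avoid132 ltn w)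
  (fun w => x ^+ desc ltn w * q ^+ v w)).
by rewrite big_indicator.
Qed.

(** The leading maximum is [n.-1]. For [n = 1] the only letter is a foremaximum, so the sum is
    empty. *)
Lemma sum_coder_213 (v : seq nat -> nat) : (0 < n)%N ->
  (forall s, st s = v (word s)) ->
  \sum_(s : 'S_n | coderangement s && avoids s [:: 2; 1; 3]%N)
     x ^+ des s * q ^+ st s
  = if n == 1%N then 0 else wsum (flip ltn) (rev (iota 0 n.-1))
      (fun w => x ^+ desc ltn (n.-1 :: rev w) * q ^+ v (n.-1 :: rev w)).
Proof.
move=> n0 stE; under eq_bigl do rewrite coderangementE avoids213E.
under eq_bigr do rewrite desE stE.
rewrite (sum_word _ (fun w => no_foremax ltn [::] w && avoid132 (flip ltn) (rev w))
  (fun w => x ^+ desc ltn w * q ^+ v w)).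
case: n n0 => [|[|m]] // _; last by rewrite sum_coder213 // sum_avoid132_rev.
rewrite big_seq_cond big1 // => w; rewrite mem_permutations => /and3P[pw + _].
by rewrite (perm_small_eq _ pw).
Qed.

End PermutationSums.

(** * Assembly of the seven identities *)

Theorem theorem5p6 (n : nat) : (1 <= n)%N ->
  let q : {poly int} := 'X in
  let eps_odd (F : {poly int}) := if odd n then F else 0 in
  let eps_even (F : {poly int}) := if odd n then 0 else F in
  (* (i) *)
  ((\sum_(s : 'S_n | avoids s [:: 1; 3; 2]%N) (-1) ^+ des s * q ^+ st2_31 s
    = \sum_(s : 'S_n | avoids s [:: 1; 3; 2]%N) (-1) ^+ des s * q ^+ st2_13 s)
   /\ \sum_(s : 'S_n | avoids s [:: 1; 3; 2]%N) (-1) ^+ des s * q ^+ st2_13 s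
      = eps_odd ((- q) ^+ n./2 * Cq n./2 (q ^+ 2))) /\
  (* (ii) *)
  ((\sum_(s : 'S_n | avoids s [:: 2; 1; 3]%N) (-1) ^+ des s * q ^+ st31_2 s
    = \sum_(s : 'S_n | avoids s [:: 2; 1; 3]%N) (-1) ^+ des s * q ^+ st13_2 s)
   /\ \sum_(s : 'S_n | avoids s [:: 2; 1; 3]%N) (-1) ^+ des s * q ^+ st13_2 s
      = eps_odd ((- q) ^+ n./2 * Cq n./2 (q ^+ 2))) /\
  (* (iii) *)
  ((\sum_(s : 'S_n | avoids s [:: 3; 1; 2]%N) (-1) ^+ des s * q ^+ st2_31 s
    = \sum_(s : 'S_n | avoids s [:: 3; 1; 2]%N) (-1) ^+ des s * q ^+ st2_13 s)
   /\ \sum_(s : 'S_n | avoids s [:: 3; 1; 2]%N) (-1) ^+ des s * q ^+ st2_13 s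
      = eps_odd ((- q) ^+ n./2 * Cq n./2 (q ^+ 2))) /\
  (* (iv) *)
  (\sum_(s : 'S_n | coderangement s && avoids s [:: 1; 3; 2]%N)
      (-1) ^+ des s * q ^+ st2_31 s
    = eps_even ((-1) ^+ n./2 * Chat n./2)) /\
  (* (v) *)
  (\sum_(s : 'S_n | coderangement s && avoids s [:: 1; 3; 2]%N)
      (- q) ^+ des s * q ^+ st31_2 s
    = eps_even ((- q) ^+ n./2 * Cbar n./2)) /\
  (* (vi) *)
  (\sum_(s : 'S_n | coderangement s && avoids s [:: 2; 1; 3]%N)
      (-1) ^+ des s * q ^+ st13_2 s
    = eps_even ((-1) ^+ n./2 * q ^+ (n - 2)./2 * Cq (n - 2)./2 (q ^+ 2))) /\
  (* (vii) *)
  (\sum_(s : 'S_n | coderangement s && avoids s [:: 2; 1; 3]%N)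
      (- q) ^+ des s * q ^+ st31_2 s
    = eps_even ((-1) ^+ n./2 * q ^+ (3 * n - 4)./2 * Cq (n - 2)./2 (q ^+ 2))).

Proof.
move=> n0 q eps_odd eps_even.
have ltnT := ltn_strict_total; have gtnT := flip_strict_total ltnT.
have nE : size (iota 0 n) = n := size_iota 0 n.
have nE' : size (rev (iota 0 n)) = n by rewrite size_rev nE.
have sI := iota_ltn_sorted 0 n; have sI' := rev_iota_sorted n.
have st2_31w := @st2_31E n; have st2_13w := @st2_13E n.
(* The double reversal presents the statistic as a function of the reversed word, on which 213
   becomes 132 for the flipped order. *)
have st31_2w (s : 'S_n) : st31_2 s = vinc ltn (rev (rev (word s))) by rewrite revK st31_2E.
have st13_2w (s : 'S_n) : st13_2 s = vinc (flip ltn) (rev (rev (word s))).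
  by rewrite revK st13_2E.
split; last split; last split; last split; last split; last split.
- rewrite (sum_des_132 (-1) q (v := fun w => vinc (flip ltn) (rev w)) st2_31w).
  rewrite (sum_des_132 (-1) q (v := fun w => vinc ltn (rev w)) st2_13w).
  by rewrite (wsum_des_2_31 q ltnT sI) ?nE // (wsum_des_2_13 q ltnT sI) ?nE.
- rewrite (sum_des_213 (-1) q (v := fun w => vinc ltn (rev w)) st31_2w).
  rewrite (sum_des_213 (-1) q (v := fun w => vinc (flip ltn) (rev w)) st13_2w).
  (* For the flipped order, 31-2 takes the place of 2-31 and 13-2 that of 2-13, both after
     reversal. *)
  by rewrite (wsum_des_2_31 q gtnT sI') ?nE' // (wsum_des_2_13 q gtnT sI') ?nE'.
- rewrite (sum_sign_312 q (v := fun w => vinc (flip ltn) (rev w)) st2_31w).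
  rewrite (sum_sign_312 q (v := fun w => vinc ltn (rev w)) st2_13w).
  (* Complementing exchanges 2-31 and 2-13, so each formula evaluates the other sum. *)
  rewrite (wsum_des_2_31 q gtnT sI') ?nE' // (wsum_des_2_13 q gtnT sI') ?nE' //.
  (* The sign from complementing is 1 for odd [n]; for even [n] both sums vanish. *)
  split=> //; rewrite /eps_odd; case: (boolP (odd n)) => no; last exact: mulr0.
  by rewrite -signr_odd (_ : odd n.-1 = false) ?mul1r //; lia.
- rewrite (sum_coder_132 (-1) q (v := fun w => vinc (flip ltn) (rev w)) st2_31w).
  rewrite (wsum_coder_2_31 q ltnT sI) nE Chat_wsum /eps_even.
  by case: (boolP (odd n)) => // no; rewrite mul2n even_halfK.
- rewrite (sum_coder_132 (- q) q (v := vinc ltn) (@st31_2E n)).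
  rewrite (wsum_coder_31_2 q ltnT sI) nE Cbar_wsum /eps_even.
  by case: (boolP (odd n)) => // no; rewrite mul2n even_halfK.
- rewrite (sum_coder_213 (-1) q (v := vinc (flip ltn)) n0 (@st13_2E n)) /eps_even.
  case: (n) n0 => [//|[//|m]] _; rewrite [m.+2 == 1%N]/= [m.+2.-1]/=.
  have sJ := rev_iota_sorted m.+1.
  have szJ : size (rev (iota 0 m.+1)) = m.+1 by rewrite size_rev size_iota.
  (* The factor -1 is the descent following the leading maximum, which adds nothing to 13-2. *)
  rewrite (@eq_wsum _ _ _ _ (fun w => -1 * ((-1) ^+ desc (flip ltn) w
      * q ^+ vinc (flip ltn) (rev w)))) => [|w]; last first.
    rewrite -perm_rev perm_sym -perm_rev revK perm_sym => pw.
    by rewrite desc_cons_max // vinc_flip_cons_max // desc_rev ?exprS ?mulrA //; apply: ltnn.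
  rewrite wsumZ (wsum_des_2_13 q gtnT sJ) ?szJ //= negbK subn2 /=.
  case: (boolP (odd m)) => mo /=; rewrite ?mulr0 // uphalf_half (negbTE mo) add0n.
  by rewrite [(- q) ^+ _]exprNn [(-1) ^+ _.+1]exprS; ring.
- rewrite (sum_coder_213 (- q) q (v := vinc ltn) n0 (@st31_2E n)) /eps_even.
  case: (n) n0 => [//|[//|m]] _; rewrite [m.+2 == 1%N]/= [m.+2.-1]/=.
  have sJ := rev_iota_sorted m.+1.
  have szJ : size (rev (iota 0 m.+1)) = m.+1 by rewrite size_rev size_iota.
  (* The leading maximum contributes one descent, hence [- q], and the number of letters above the
     letter after it; in the reversed word and flipped order these lie below the last letter. *)
  rewrite (@eq_wsum _ _ _ _ (fun w => - q * ((- q) ^+ desc (flip ltn) w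
      * q ^+ vinc (flip (flip ltn)) (rev w)
      * q ^+ above_head (flip (flip ltn)) (rev w)))) => [|w]; last first.
    rewrite -perm_rev perm_sym -perm_rev revK perm_sym => pw.
    rewrite desc_cons_max // vinc_cons_max // desc_rev; last exact: ltnn.
    by rewrite exprS exprD !mulrA.
  rewrite wsumZ (wsum_des_2_31_below_last q gtnT sJ) ?szJ //= negbK subn2 /=.
  case: (boolP (odd m)) => mo /=; rewrite ?mulr0 // uphalf_half (negbTE mo) add0n.
  have -> : ((3 * m.+2 - 4)./2 = (3 * m./2).+1)%N by lia.
  by rewrite [(- q ^+ 3) ^+ _]exprNn -exprM [(-1) ^+ _.+1]exprS [q ^+ _.+1]exprS; ring.
Qed.
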